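(* Let $L$ be a maximal (with respect to inclusion) locally nilpotent subalgebra of the Lie algebra $W(A)$ such that $\operatorname{rk}_R L=3$. Let $F=F(L)$ be the field of constants for $L$. Then $FL=L$ and $L$ is a Lie algebra over $F$ of one of the following types: (1) $L$ is a nilpotent Lie algebra of dimension $3$ over $F$; (2) $L=F\left\langle D_3,\ \left\{\frac{a^i}{i!}D_1\right\}_{i=0}^{\infty},\ \left\{\frac{a^i}{i!}D_2\right\}_{i=0}^{\infty}\right\rangle$, where $D_1,D_2,D_3\in L$ and $a\in R$ are such that $D_1(a)=D_2(a)=0$, $D_3(a)=1$, and $[D_i,D_j]=0$ for all $i,j=1,2,3$; (3) $L=F\left\langle D_3,\ \left\{\frac{a^i}{i!}D_2\right\}_{i=0}^{\infty},\ \left\{\frac{a^ib^j}{i!j!}D_1\right\}_{i,j=0}^{\infty}\right\rangle$, where $D_1,D_2,D_3\in L$ and $a,b\in R$ are such that $D_1(a)=D_2(a)=0$, $D_3(a)=1$, $D_1(b)=D_3(b)=0$, $D_2(b)=1$, and $[D_i,D_j]=0$ for all $i,j=1,2,3$.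
   Context: $\mathbb K$ is an arbitrary field of characteristic zero, $A$ is an associative-commutative $\mathbb K$-algebra that is an integral domain, and $R=\operatorname{Frac}(A)$ is its fraction field. $\operatorname{Der}_{\mathbb K}A$ is the Lie algebra of all $\mathbb K$-derivations of $A$; each such derivation extends uniquely to a $\mathbb K$-derivation of $R$. For $r\in R$ and a derivation $D$ of $R$, $rD$ is the derivation $x\mapsto r\cdot D(x)$ of $R$. $W(A):=R\operatorname{Der}_{\mathbb K}A$ is the $R$-linear span of $\{rD\mid r\in R,\ D\in\operatorname{Der}_{\mathbb K}A\}$; it is a Lie subalgebra over $\mathbb K$ of $\operatorname{Der}_{\mathbb K}R$. ''Subalgebra'' of $W(A)$ means Lie subalgebra over $\mathbb K$. For a subalgebra $L\subseteq W(A)$: $RL$ is the $R$-linear span of $L$ in $W(A)$; the rank of $L$ over $R$ is $\operatorname{rk}_R L=\dim_R RL$; the field of constants for $L$ is the subfield $F=F(L)=\{r\in R\mid D(r)=0\text{ for all }D\in L\}$ of $R$. $FL$ denotes the $F$-linear span of $L$; it is a Lie algebra over $F$. $F\langle\,\cdots\rangle$ denotes the $F$-linear span of the listed elements. A Lie algebra is locally nilpotent if every finitely generated subalgebra of it is nilpotent. *)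

(* Defs.v *)
From HB Require Import structures.
From mathcomp Require Import all_boot all_order all_algebra.
From mathcomp Require Import boolp classical_sets functions cardinality.

Set Implicit Arguments.
Unset Strict Implicit.
Unset Printing Implicit Defensive.

Import GRing.Theory.
Local Open Scope classical_set_scope.
Local Open Scope ring_scope.

#[short(type="idomainAlgType")]
HB.structure Definition IntegralDomainAlgebra (K : nzRingType) :=
  { A of GRing.IntegralDomain A & GRing.Algebra K A }.

(* R^o makes the pointwise structure on R -> R^o that of an R-vector space, so
   that (r *: D) x is r * D x. *)
Notation selfmap R := (R -> R^o).

Section LinearAlgebra.
Variables (R : fieldType) (V : lmodType R).
Implicit Types (S : set R) (X : set V).

Definition lspan S X : set V :=
  [set v | exists (n : nat) (c : 'I_n -> R) (x : 'I_n -> V),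
    [/\ forall i, S (c i), forall i, X (x i) & v = \sum_i c i *: x i]].

Definition subspace S X : Prop :=
  [/\ X 0, forall u v, X u -> X v -> X (u + v)
    & forall c v, S c -> X v -> X (c *: v)].

Definition lin_indep S n (v : 'I_n -> V) : Prop :=
  forall c : 'I_n -> R, (forall i, S (c i)) ->
    \sum_i c i *: v i = 0 -> forall i, c i = 0.

Definition has_dim S X (n : nat) : Prop :=
  exists v : 'I_n -> V, lin_indep S v /\ X = lspan S (range v).

End LinearAlgebra.

(* Throughout, the ground field is a subset S of R (in use: the image of the
   base field, the field of constants F, or all of R), so that one carrier can
   be regarded as a Lie algebra over several fields. *)
Section LieAlgebra.
Variable R : fieldType.
Implicit Types (S : set R) (D E : selfmap R) (L M W X : set (selfmap R)).

Definition bracket D E : selfmap R := fun x => D (E x) - E (D x).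

Definition lie_subalgebra S W L : Prop :=
  [/\ L `<=` W, subspace S L
    & forall D E, L D -> L E -> L (bracket D E)].

(* The bracket is S-bilinear only when the elements of L are S-linear, so
   bilinearity is part of the definition. *)
Definition lie_algebra_over S L : Prop :=
  [/\ subspace S L,
      forall D E, L D -> L E -> L (bracket D E),
      forall c D D' E, S c -> L D -> L D' -> L E ->
        bracket (c *: D + D') E = c *: bracket D E + bracket D' E
        /\ bracket E (c *: D + D') = c *: bracket E D + bracket E D',
      forall D, L D -> bracket D D = 0
    & forall D E G, L D -> L E -> L G ->
        bracket D (bracket E G) + bracket E (bracket G D)
          + bracket G (bracket D E) = 0].

Fixpoint lower_central S L (k : nat) : set (selfmap R) :=
  if k is k'.+1 then
    lspan S [set G | exists D E,
      [/\ L D, lower_central S L k' E & G = bracket D E]]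
  else L.

Definition nilpotent S L : Prop := exists k, lower_central S L k = [set 0].

Definition generated_subalgebra S L X : set (selfmap R) :=
  \bigcap_(M in [set M | lie_subalgebra S L M /\ X `<=` M]) M.

Definition locally_nilpotent S L : Prop :=
  forall X, finite_set X -> X `<=` L ->
    nilpotent S (generated_subalgebra S L X).

Definition maximal_locally_nilpotent S W L : Prop :=
  [/\ lie_subalgebra S W L, locally_nilpotent S L
    & forall M, lie_subalgebra S W M -> locally_nilpotent S M ->
        L `<=` M -> M = L].

Definition rank_eq L (n : nat) : Prop := has_dim setT (lspan setT L) n.

Definition constants L : set R := [set r | forall D, L D -> D r = 0].

Definition pairwise_commute X : Prop :=
  forall D E, X D -> X E -> bracket D E = 0.

(* Divided power a^i/i!, meaningful in characteristic zero. *)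
Definition dpow (a : R) (i : nat) : R := a ^+ i / i`!%:R.

Definition type1 L : Prop :=
  nilpotent (constants L) L /\ has_dim (constants L) L 3.

Definition type2 L : Prop :=
  exists (D1 D2 D3 : selfmap R) (a : R),
  [/\ [set D1; D2; D3] `<=` L,
      [/\ D1 a = 0, D2 a = 0 & D3 a = 1],
      pairwise_commute [set D1; D2; D3]
    & L = lspan (constants L)
            ([set D3]
             `|` range (fun i : nat => dpow a i *: D1)
             `|` range (fun i : nat => dpow a i *: D2))].

Definition type3 L : Prop :=
  exists (D1 D2 D3 : selfmap R) (a b : R),
  [/\ [set D1; D2; D3] `<=` L,
      [/\ D1 a = 0, D2 a = 0 & D3 a = 1],
      [/\ D1 b = 0, D3 b = 0 & D2 b = 1],
      pairwise_commute [set D1; D2; D3]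
    & L = lspan (constants L)
            ([set D3]
             `|` range (fun i : nat => dpow a i *: D2)
             `|` range (fun ij : nat * nat =>
                          (dpow a ij.1 * dpow b ij.2) *: D1))].

End LieAlgebra.

Section Derivations.
Variable K : fieldType.

(* The K-algebra structure of B is given by its structure map iota. *)
Definition derivation (B : comNzRingType) (iota : {rmorphism K -> B})
    (D : B -> B) : Prop :=
  [/\ forall x y, D (x + y) = D x + D y,
      forall k x, D (iota k * x) = iota k * D x
    & forall x y, D (x * y) = D x * y + x * D y].

Variable A : idomainAlgType K.

Definition frac_alg : {rmorphism K -> {fraction A}} := @tofrac A \o in_alg A.

(* The extensions to Frac(A) of the K-derivations of A. *)
Definition ext_der : set (selfmap {fraction A}) :=
  [set D | derivation frac_alg D /\
     exists2 d : A -> A, derivation (in_alg A) d &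
       forall x, D (tofrac x) = tofrac (d x)].

Definition WA : set (selfmap {fraction A}) := lspan setT ext_der.

End Derivations.

Arguments frac_alg {K} A.
Arguments ext_der {K} A.
Arguments WA {K} A.

(* Main.v *)
Require Import Defs.
From HB Require Import structures.
From mathcomp Require Import all_boot all_order all_algebra.
From mathcomp Require Import boolp classical_sets functions cardinality.
From mathcomp Require Import ring zify.

Set Implicit Arguments.
Unset Strict Implicit.
Unset Printing Implicit Defensive.

Import GRing.Theory.
Local Open Scope classical_set_scope.
Local Open Scope ring_scope.

(** Let [L] be maximal locally nilpotent of rank three, and [F] its field of
    constants.

    Let [U] be an [R]-subspace stable under brackets with [L]. Finitely
    generated subalgebras of [L] are nilpotent, so each of them that is not
    contained in [U] has elements outside [U] which are central modulo [U].
    Elements that are linearly independent over [F] modulo [U] and commute,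
    modulo [U], with a subset of [L] having no constants but [F] are also
    independent over [R]. As the rank is finite, the central elements cannot
    keep changing when the subalgebra grows: some element of [L] outside [U] is
    central modulo [U] in the whole of [L] ([central_step]). Three uses of this
    give [X1], [X2], [X3] in [L], a basis of [R L] over [R], such that [X1] is
    central, [[L, X2]] lies in [R X1] and [[L, X3]] in [R X1 + R X2]
    ([adapted_flag]); in particular [[X3, X2] = t X1] for some [t] in [R].

    Let [N] be the ring of functions killed by [X1] on which [X2] and [X3] act
    nilpotently; on it [X2] and [X3] commute. Comparing coordinates in the
    brackets of [L] with [X1], [X2], [X3] shows that [L] is contained in [M = F
    X3 + (N :&: ker X2) X2 + N X1] ([adapted_frame]). Now [M] is itself a Lie
    algebra, and a locally nilpotent one: give [X3] the weight 1 and [X2] a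
    large weight [m], so that the [X2]-coefficients of finitely many elements
    have degree below [m]. Brackets with these elements then lower the weighted
    degree of the coefficients ([bounded_model_bracket_layer],
    [model_locally_nilpotent]). By maximality [L = M], which already makes [L]
    a Lie algebra over [F].

    It remains to describe [M]. If [N = F], it has dimension three. If [N :&:
    ker X2] is larger than [F], dividing a last nonconstant iterate of [X3] by
    its derivative gives [a] with [X2 a = 0] and [X3 a = 1], and integration
    shows that [N :&: ker X2 = F[a]]. Either that is all of [N], or there is
    also [b] with [X2 b = 1] and [X3 b = 0], and [N = F[a, b]]. In both cases
    [t = X3 s] for some [s] in [N], and [X1], [X2 - s X1], [X3] commute: these
    are the second and the third type. In the remaining case [N :&: ker X2 = F]
    while [N] is larger; then [X2] has a slice and, after subtracting from [X3]
    a multiple of [X2], the two derivations can exchange their roles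
    ([exchange_frame]). The model of the new frame contains [L], so that it
    equals [L] by maximality, and the previous case applies to it. *)

(** * Spans and linear dependence *)
Section Span.
Variables (R : fieldType) (V : lmodType R).
Implicit Types (S : set R) (X Y : set V).

Lemma lspan_min S X Y : subspace S Y -> X `<=` Y -> lspan S X `<=` Y.
Proof.
move=> [Y0 YD YZ] XY _ [n [c [x [Sc Xx ->]]]].
by elim/big_ind: _ => // i _; apply: YZ => //; apply: XY.
Qed.

Lemma sub_lspan S X : S 1 -> X `<=` lspan S X.
Proof.
move=> S1 v Xv; exists 1%N, (fun=> 1), (fun=> v).
by split => //; rewrite big_ord1 scale1r.
Qed.

Lemma lspan_subspace S X :
  (forall c d, S c -> S d -> S (c * d)) -> subspace S (lspan S X).
Proof.
move=> SM; split.
- by exists 0%N, (fun=> 0), (fun=> 0); split => [[]|[]|] //; rewrite big_ord0.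
- move=> _ _ [n [c [x [Sc Xx ->]]]] [m [d [y [Sd Xy ->]]]].
  exists (n + m)%N,
    (fun i : 'I_(n + m) =>
       match fintype.split i with inl j => c j | inr j => d j end),
    (fun i : 'I_(n + m) =>
       match fintype.split i with inl j => x j | inr j => y j end); split.
  + by move=> i; case: fintype.split.
  + by move=> i; case: fintype.split.
  + rewrite big_split_ord /=; congr (_ + _); apply: eq_bigr => i _.
      by rewrite (unsplitK (inl i)).
    by rewrite (unsplitK (inr i)).
- move=> a _ Sa [n [c [x [Sc Xx ->]]]].
  exists n, (fun i => a * c i), x; split => //; first by move=> i; apply: SM.
  by rewrite scaler_sumr; apply: eq_bigr => i _; rewrite scalerA.
Qed.

Lemma subspace_sum S X n (c : 'I_n -> R) (x : 'I_n -> V) :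
  subspace S X -> (forall i, S (c i)) -> (forall i, X (x i)) ->
  X (\sum_i c i *: x i).
Proof.
move=> subX Sc Xx; have := lspan_min subX (@subset_refl _ X); apply.
by exists n, c, x.
Qed.

End Span.

Lemma subspace_sub (R : fieldType) (V : lmodType R) (S S' : set R) (X : set V) :
  S' `<=` S -> subspace S X -> subspace S' X.
Proof. by move=> sS [X0 XD XZ]; split => // c v /sS; apply: XZ. Qed.

Section LinearDependence.
Variables (R : fieldType) (V : lmodType R).

Lemma lspan_rangeP n (v : 'I_n -> V) u :
  lspan setT (range v) u -> exists a : 'I_n -> R, u = \sum_i a i *: v i.
Proof.
apply: (@lspan_min _ _ _ _ [set u | exists a : 'I_n -> R, u = \sum_i a i *: v i]).
  split.
  - by exists (fun=> 0); rewrite big1 // => i _; rewrite scale0r.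
  - move=> _ _ [a ->] [b ->]; exists (fun i => a i + b i).
    by rewrite -big_split; apply: eq_bigr => i _; rewrite scalerDl.
  - move=> c _ _ [a ->]; exists (fun i => c * a i).
    by rewrite scaler_sumr; apply: eq_bigr => i _; rewrite scalerA.
move=> _ [i _ <-]; exists (fun j => (j == i)%:R).
rewrite (bigD1 i) //= eqxx scale1r big1 ?addr0 // => j /negbTE ->.
by rewrite scale0r.
Qed.

(** The matrix of coefficients has one row more than it has columns, hence a
    nonzero row vector in its kernel. *)
Lemma span_dependent n (v : 'I_n -> V) (w : 'I_n.+1 -> V) :
  (forall i, lspan setT (range v) (w i)) -> ~ lin_indep setT w.
Proof.
move=> wv indep.
have /choice[a wE] : forall i, exists a : 'I_n -> R, w i = \sum_j a j *: v j.
  by move=> i; apply: lspan_rangeP.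
pose A := \matrix_(i < n.+1, j < n) a i j.
have : kermx A != 0.
  by rewrite kermx_eq0 /row_free neq_ltn ltnS rank_leq_col.
case/rowV0Pn => u /sub_kermxP uA /eqP u0; apply: u0.
apply/rowP => i; rewrite mxE; apply: (indep (u 0)) => // {i}.
under eq_bigr => i _ do rewrite wE scaler_sumr.
rewrite exchange_big big1 // => j _.
under eq_bigr => i _ do rewrite scalerA.
have := congr1 (fun B : 'rV_n => B 0 j) uA; rewrite !mxE => uA0.
rewrite -scaler_suml (_ : \sum_i _ = 0) ?scale0r // -[RHS]uA0.
by apply: eq_bigr => i _; rewrite mxE.
Qed.

End LinearDependence.

Section Plane.
Variables (R : fieldType) (V : lmodType R).

Implicit Types X Y : V.

(** [X] and [Y] may vanish: the members of the flag of dimensions 0, 1 and 2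
    are [plane 0 0], [plane X1 0] and [plane X1 X2], which lets one lemma serve
    for all the steps of the construction. *)
Definition plane (X Y : V) : set V :=
  [set v | exists r s : R, v = r *: X + s *: Y].

Lemma scale_solve c X Y : c != 0 -> Y + c *: X = 0 -> X = - c^-1 *: Y.
Proof.
move=> c0 /(canRL (addKr _)); rewrite addr0 => /(canRL (scalerK c0)) ->.
by rewrite scaleNr scalerN.
Qed.

Lemma plane_subspace X Y : subspace setT (plane X Y).
Proof.
split.
- by exists 0, 0; rewrite !scale0r addr0.
- move=> _ _ [r [s ->]] [r' [s' ->]]; exists (r + r'), (s + s').
  by rewrite !scalerDl addrACA.
- by move=> c _ _ [r [s ->]]; exists (c * r), (c * s); rewrite scalerDr !scalerA.
Qed.

Lemma plane_not_span X Y (v : 'I_3 -> V) :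
  lin_indep setT v -> ~ range v `<=` plane X Y.
Proof.
move=> indep vXY.
pose w (i : 'I_2) := if val i == 0%N then X else Y.
apply: (span_dependent (v := w) (w := v)) => // i.
have [|r [s ->]] := vXY (v i); first by exists i.
exists 2%N, (fun i : 'I_2 => if val i == 0%N then r else s), w; split => //.
by rewrite !big_ord_recl big_ord0 addr0 /w /=.
Qed.

End Plane.

(** * Derivations and their brackets *)
Section Derivations.
Variable R : fieldType.
Implicit Types (D E : selfmap R) (r x y : R).

Definition is_der D : Prop :=
  (forall x y : R, D (x + y) = D x + D y :> R) /\
  (forall x y : R, D (x * y) = D x * y + x * D y :> R).

Section OneDerivation.
Variables (D : selfmap R) (dD : is_der D).

Lemma derD x y : D (x + y) = D x + D y :> R. Proof. exact: dD.1. Qed.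

Lemma derM x y : D (x * y) = D x * y + x * D y :> R.
Proof. exact: dD.2. Qed.

Lemma der0 : D 0 = 0 :> R.
Proof. by apply: (addrI (D 0 : R)); rewrite -derD !addr0. Qed.

Lemma derN x : D (- x) = - (D x : R) :> R.
Proof. by apply: (addrI (D x : R)); rewrite -derD !subrr der0. Qed.

Lemma derB x y : D (x - y) = (D x : R) - D y :> R.
Proof. by rewrite derD derN. Qed.

Lemma der1 : D 1 = 0 :> R.
Proof.
by apply: (addrI (D 1 : R)); rewrite addr0 -{3}[1]mulr1 derM mulr1 mul1r.
Qed.

Lemma derZ c x : D c = 0 :> R -> D (c * x) = c * (D x : R) :> R.
Proof. by move=> Dc; rewrite derM Dc mul0r add0r. Qed.

Lemma der_sum I (s : seq I) (f : I -> R) :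
  D (\sum_(i <- s) f i) = \sum_(i <- s) (D (f i) : R) :> R.
Proof.
by elim: s => [|i s IHs]; rewrite ?big_nil ?der0 // !big_cons derD IHs.
Qed.

Lemma der_iter0 k : iter k D 0 = 0 :> R.
Proof. by elim: k => //= k ->; rewrite der0. Qed.

Lemma der_iterD k x y : iter k D (x + y) = iter k D x + iter k D y :> R.
Proof. by elim: k => //= k ->; rewrite derD. Qed.

Lemma der_iterZ k c x :
  D c = 0 :> R -> iter k D (c * x) = c * iter k D x :> R.
Proof. by move=> Dc; elim: k => //= k ->; rewrite derZ. Qed.

Lemma der_iter_ge k l x : (k <= l)%N -> iter k D x = 0 :> R ->
  iter l D x = 0 :> R.
Proof. by move=> /subnK <- x0; rewrite iterD x0 der_iter0. Qed.

Lemma derV x : D x = 0 :> R -> D x^-1 = 0 :> R.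
Proof.
move=> Dx; have [->|x0] := eqVneq x 0; first by rewrite invr0 der0.
apply: (mulfI x0); rewrite mulr0 -(derZ _ Dx) divff //; exact: der1.
Qed.

End OneDerivation.

Lemma addE D E x : (D + E) x = (D x : R) + E x :> R. Proof. by []. Qed.

Lemma oppE D x : (- D) x = - (D x : R) :> R. Proof. by []. Qed.

Lemma scaleE c D x : (c *: D) x = c * (D x : R) :> R. Proof. by []. Qed.

Lemma bracketE D E x : bracket D E x = (D (E x) : R) - E (D x) :> R.
Proof. by []. Qed.

Lemma selfmapP D E : (forall x, D x = E x :> R) -> D = E.
Proof. by move=> DE; apply/funext. Qed.

Lemma is_derD D E : is_der D -> is_der E -> is_der (D + E).
Proof.
move=> dD dE; split => x y; rewrite !addE.
  by rewrite (derD dD) (derD dE); ring.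
by rewrite (derM dD) (derM dE); ring.
Qed.

Lemma is_derZ c D : is_der D -> is_der (c *: D).
Proof.
move=> dD; split => x y; rewrite !scaleE.
  by rewrite (derD dD); ring.
by rewrite (derM dD); ring.
Qed.

Lemma is_der0 : is_der 0.
Proof. by split => x y; rewrite /= ?addr0 // mul0r mulr0 addr0. Qed.

Lemma bracketDr D E G : is_der D ->
  bracket D (E + G) = bracket D E + bracket D G.
Proof.
by move=> dD; apply: selfmapP => x; rewrite !(addE, bracketE) (derD dD); ring.
Qed.

Lemma bracketZr D r E : is_der D ->
  bracket D (r *: E) = (D r : R) *: E + r *: bracket D E.
Proof.
move=> dD; apply: selfmapP => x; rewrite !(addE, bracketE, scaleE) (derM dD).
by ring.
Qed.

Lemma bracket0r D : is_der D -> bracket D 0 = 0.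
Proof.
move=> dD; apply: selfmapP => x.
by rewrite bracketE (der0 dD) /= subr0.
Qed.

Lemma bracketC D E : bracket D E = - bracket E D.
Proof. by apply: selfmapP => x; rewrite oppE !bracketE opprB. Qed.

Lemma bracketDD D : bracket D D = 0.
Proof. by apply: selfmapP => x; rewrite bracketE subrr. Qed.

Lemma bracket_sumr D n (c : 'I_n -> R) (w : 'I_n -> selfmap R) : is_der D ->
  bracket D (\sum_i c i *: w i) =
  \sum_i (D (c i) : R) *: w i + \sum_i c i *: bracket D (w i).
Proof.
move=> dD; rewrite -big_split /=.
apply: (big_ind2 (fun E G => bracket D E = G)) => [|E E' G G' <- <-|i _].
- exact: bracket0r.
- exact: bracketDr.
- exact: bracketZr.
Qed.

End Derivations.

Ltac pointwise :=
  apply: selfmapP => ?; rewrite !(addE, oppE, scaleE); ring.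

(** * Frames, nil functions and weighted degrees *)
Section Frame.
Variable R : fieldType.
Implicit Types (D E : selfmap R) (S : set R) (r x y : R).

Definition joint_constants (X1 X2 X3 : selfmap R) : set R :=
  [set r | [/\ X1 r = 0, X2 r = 0 & X3 r = 0]].

Definition nilpotent_at D r := exists k, iter k D r = 0 :> R.

(** Polynomials in the slices of the frame: in the end this is [F], [F[a]] or
    [F[a, b]]. *)
Definition nil_functions (X1 X2 X3 : selfmap R) : set R :=
  [set n | [/\ X1 n = 0 :> R, nilpotent_at X2 n & nilpotent_at X3 n]].

(** The shape in which all three types are found. The coefficients of [X2] are
    taken in the kernel of [X2], which makes the elements [q *: X2] commute
    with one another. *)
Definition model (X1 X2 X3 : selfmap R) : set (selfmap R) :=
  [set D | exists c q n, [/\ joint_constants X1 X2 X3 c,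
     nil_functions X1 X2 X3 q /\ X2 q = 0, nil_functions X1 X2 X3 n
     & D = c *: X3 + q *: X2 + n *: X1]].

(** The derivations [X1], [X2], [X3] stand for [D1], [D2], [D3] before the
    latter are made to commute: the defect of commutation, [t *: X1], vanishes
    on the functions killed by [X1]. *)
Record frame (X1 X2 X3 : selfmap R) (t : R) : Prop := Frame {
  frame_der1 : is_der X1;
  frame_der2 : is_der X2;
  frame_der3 : is_der X3;
  frame_comm12 : forall x, X1 (X2 x) = X2 (X1 x) :> R;
  frame_comm13 : forall x, X1 (X3 x) = X3 (X1 x) :> R;
  frame_comm32 : forall x, X3 (X2 x) = X2 (X3 x) + t * X1 x :> R;
  frame_nil : nil_functions X1 X2 X3 t
}.

Section Filtration.
Variables (X1 X2 X3 : selfmap R) (t : R).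
Hypothesis fr : frame X1 X2 X3 t.
Let d1 := frame_der1 fr.
Let d2 := frame_der2 fr.
Let d3 := frame_der3 fr.
Local Notation N := (nil_functions X1 X2 X3).
Local Notation F := (joint_constants X1 X2 X3).

Definition ker1 : set R := [set x | X1 x = 0].

Lemma ker1_X2 x : ker1 x -> ker1 (X2 x).
Proof. by rewrite /ker1 /= (frame_comm12 fr) => ->; rewrite (der0 d2). Qed.

Lemma ker1_X3 x : ker1 x -> ker1 (X3 x).
Proof. by rewrite /ker1 /= (frame_comm13 fr) => ->; rewrite (der0 d3). Qed.

Lemma ker1_iter2 k x : ker1 x -> ker1 (iter k X2 x).
Proof. by move=> x1; elim: k => //= k; apply: ker1_X2. Qed.

Lemma ker1_iter3 k x : ker1 x -> ker1 (iter k X3 x).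
Proof. by move=> x1; elim: k => //= k; apply: ker1_X3. Qed.

Lemma comm23 x : ker1 x -> X3 (X2 x) = X2 (X3 x).
Proof. by move=> x1; rewrite (frame_comm32 fr) x1 mulr0 addr0. Qed.

Lemma comm_iter3 j x : ker1 x -> iter j X3 (X2 x) = X2 (iter j X3 x).
Proof.
move=> x1; elim: j => //= j ->; rewrite comm23 //; exact: ker1_iter3.
Qed.

Lemma comm_iter23 i j x :
  ker1 x -> iter i X2 (iter j X3 x) = iter j X3 (iter i X2 x).
Proof.
move=> x1; elim: i => //= i ->; rewrite comm_iter3 //; exact: ker1_iter2.
Qed.

Variable m : nat.

(** Functions of weighted degree less than [d], where [X3] lowers the degree by
    1 and [X2] lowers it by [m]. The bound is strict so that [d = 0] describes
    the zero function. *)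
Definition deg_below (d : nat) : set R :=
  [set n | ker1 n /\
     forall i j, (d <= m * i + j)%N -> iter i X2 (iter j X3 n) = 0 :> R].

Lemma deg_below0 x : deg_below 0 x -> x = 0.
Proof. by case=> _ /(_ 0%N 0%N); apply. Qed.

Lemma deg_below_zero d : deg_below d 0.
Proof.
split => [|i j _]; first by rewrite /ker1 /= (der0 d1).
by rewrite (der_iter0 d3) (der_iter0 d2).
Qed.

Lemma deg_below_le d e x : (d <= e)%N -> deg_below d x -> deg_below e x.
Proof. by move=> de [x1 xd]; split => // i j /(leq_trans de); apply: xd. Qed.

Lemma deg_belowD d x y : deg_below d x -> deg_below d y -> deg_below d (x + y).
Proof.
move=> [x1 xd] [y1 yd]; split; first by rewrite /ker1 /= (derD d1) x1 y1 addr0.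
by move=> i j dij; rewrite (der_iterD d3) (der_iterD d2) xd // yd // addr0.
Qed.

Lemma deg_belowZ d c x : F c -> deg_below d x -> deg_below d (c * x).
Proof.
move=> [c1 c2 c3] [x1 xd]; split; first by rewrite /ker1 /= derZ // x1 mulr0.
by move=> i j dij; rewrite !der_iterZ // xd // mulr0.
Qed.

Lemma deg_belowN d x : deg_below d x -> deg_below d (- x).
Proof.
rewrite -mulN1r; apply: deg_belowZ.
by split; rewrite derN // der1 // oppr0.
Qed.

Lemma deg_below_X3 d x : deg_below d x -> deg_below d.-1 (X3 x).
Proof.
move=> [x1 xd]; split => [|i j dij]; first exact: ker1_X3.
by rewrite -iterSr xd // addnS; lia.
Qed.

Lemma deg_below_X2 d x : deg_below d x -> deg_below (d - m) (X2 x).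
Proof.
move=> [x1 xd]; split => [|i j dij]; first exact: ker1_X2.
by rewrite comm_iter3 // -iterSr xd // mulnS; lia.
Qed.

(** The Leibniz rule distributes the derivations over the two factors; a factor
    whose bound has dropped to 0 vanishes, which takes care of the truncated
    subtractions. *)
Lemma deg_belowM d e x y :
  deg_below d x -> deg_below e y -> deg_below (d + e).-1 (x * y).
Proof.
have mul_iter i j d' e' x' y' : deg_below d' x' -> deg_below e' y' ->
    (d' + e' <= (m * i + j).+1)%N -> iter i X2 (iter j X3 (x' * y')) = 0 :> R.
  elim: j d' e' x' y' => [|j IHj] d' e' x' y' fx fy; last first.
    case: d' fx => [/deg_below0 ->|d' fx] de.
      by rewrite mul0r (der_iter0 d3) (der_iter0 d2).
    case: e' fy de => [/deg_below0 -> _|e' fy de].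
      by rewrite mulr0 (der_iter0 d3) (der_iter0 d2).
    rewrite iterSr (derM d3) (der_iterD d3) (der_iterD d2).
    have -> := IHj _ _ _ _ (deg_below_X3 fx) fy; last by lia.
    by have -> := IHj _ _ _ _ fx (deg_below_X3 fy); rewrite ?addr0 //=; lia.
  rewrite /=.
  elim: i d' e' x' y' fx fy => [|i IHi] d' e' x' y' fx fy de.
    case: d' fx de => [/deg_below0 -> _|d' fx de]; first by rewrite mul0r.
    case: e' fy de => [/deg_below0 -> _|e' fy de]; first by rewrite mulr0.
    by lia.
  rewrite iterSr (derM d2) (der_iterD d2).
  have -> : iter i X2 ((X2 x' : R) * y') = 0 :> R.
    have [le_dm|lt_md] := leqP d' m.
      have /eqP d'm : (d' - m)%N == 0%N by rewrite subn_eq0.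
      by have := deg_below_X2 fx; rewrite d'm => /deg_below0 ->;
        rewrite mul0r der_iter0.
    by apply: (IHi _ _ _ _ (deg_below_X2 fx) fy); lia.
  have -> : iter i X2 (x' * (X2 y' : R)) = 0 :> R.
    have [le_em|lt_me] := leqP e' m.
      have /eqP e'm : (e' - m)%N == 0%N by rewrite subn_eq0.
      by have := deg_below_X2 fy; rewrite e'm => /deg_below0 ->;
        rewrite mulr0 der_iter0.
    by apply: (IHi _ _ _ _ fx (deg_below_X2 fy)); lia.
  by rewrite addr0.
move=> fx fy; split.
  by rewrite /ker1 /= (derM d1) fx.1 fy.1 mul0r mulr0 addr0.
by move=> i j dij; apply: mul_iter fx fy _; lia.
Qed.

(** A monomial in [X2] and [X3] of weighted degree at least [m * k + l]
    contains [X2] at least [k] times or [X3] at least [l] times. *)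
Lemma nil_deg_below n : N n -> exists d, deg_below d n.
Proof.
move=> [n1 [k nk] [l nl]]; exists (m * k + l)%N; split => // i j dij.
have [le_lj|lt_jl] := leqP l j.
  by rewrite (der_iter_ge d3 le_lj nl) (der_iter0 d2).
rewrite comm_iter23 // (der_iter_ge d2 (_ : k <= i)%N nk) ?(der_iter0 d3) //.
by rewrite leqNgt; apply/negP => lt_ik; nia.
Qed.

Lemma deg_below_nil d n : (0 < m)%N -> deg_below d n -> N n.
Proof.
move=> m0 [n1 nd]; split => //.
  by exists d; have := nd d 0%N; apply; rewrite addn0 leq_pmull.
by exists d; have := nd 0%N d; apply; rewrite muln0.
Qed.

End Filtration.

End Frame.

(** * Local nilpotency of the models *)
Lemma finite_uniform_bound (T : choiceType) (X : set T) (P : T -> nat -> Prop) :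
  finite_set X -> (forall x d e, (d <= e)%N -> P x d -> P x e) ->
  (forall x, X x -> exists d, P x d) -> exists d, forall x, X x -> P x d.
Proof.
move=> /finite_seqP[s ->] Pmono; elim: s => [|x s IHs] PX; first by exists 0%N.
have [|d Pd] := IHs; first by move=> y ys; apply: PX; rewrite /= inE ys orbT.
have [|e Pe] := PX x; first by rewrite /= mem_head.
exists (maxn d e) => y /=; rewrite inE => /predU1P[->|/Pd].
  by apply: Pmono Pe; apply: leq_maxr.
by apply: Pmono; apply: leq_maxl.
Qed.

Section FrameAlgebra.
Variable R : fieldType.
Implicit Types (D E : selfmap R) (S : set R) (r x y : R).
Variables (X1 X2 X3 : selfmap R) (t : R).
Hypothesis fr : frame X1 X2 X3 t.
Let d1 := frame_der1 fr.
Let d2 := frame_der2 fr.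
Let d3 := frame_der3 fr.
Local Notation N := (nil_functions X1 X2 X3).
Local Notation F := (joint_constants X1 X2 X3).
Local Notation M := (model X1 X2 X3).
Local Notation deg_below := (deg_below X1 X2 X3).

Lemma nilM x y : N x -> N y -> N (x * y).
Proof.
move=> /(nil_deg_below fr 1)[d xd] /(nil_deg_below fr 1)[e ye].
exact: (deg_below_nil (m := 1) isT (deg_belowM fr xd ye)).
Qed.

Lemma nilD x y : N x -> N y -> N (x + y).
Proof.
move=> /(nil_deg_below fr 1)[d xd] /(nil_deg_below fr 1)[e ye].
apply: (@deg_below_nil _ X1 X2 X3 1 (maxn d e)) => //.
by apply: (deg_belowD fr); [apply: deg_below_le xd|apply: deg_below_le ye];
  rewrite ?leq_maxl ?leq_maxr.
Qed.

Lemma nil_X2 x : N x -> N (X2 x).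
Proof.
by move=> /(nil_deg_below fr 1)[d /(deg_below_X2 fr) /(deg_below_nil (m := 1) isT)].
Qed.

Lemma nil_X3 x : N x -> N (X3 x).
Proof.
by move=> /(nil_deg_below fr 1)[d /(deg_below_X3 fr) /(deg_below_nil (m := 1) isT)].
Qed.

Lemma nil_const c : F c -> N c.
Proof. by move=> [c1 c2 c3]; split => //; exists 1%N. Qed.

Lemma nilZ c x : F c -> N x -> N (c * x).
Proof. by move=> /nil_const; apply: nilM. Qed.

Lemma constM c d : F c -> F d -> F (c * d).
Proof.
move=> [c1 c2 c3] [e1 e2 e3].
by split; rewrite derZ // ?e1 ?e2 ?e3 mulr0.
Qed.

Lemma constN c : F c -> F (- c).
Proof. by move=> [c1 c2 c3]; split; rewrite derN // ?c1 ?c2 ?c3 oppr0. Qed.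

Lemma constD c d : F c -> F d -> F (c + d).
Proof.
move=> [c1 c2 c3] [e1 e2 e3].
by split; rewrite derD // ?c1 ?c2 ?c3 ?e1 ?e2 ?e3 addr0.
Qed.

Lemma const0 : F 0. Proof. by split; rewrite der0. Qed.

Lemma const1 : F 1. Proof. by split; rewrite der1. Qed.

Lemma nilN x : N x -> N (- x).
Proof. by rewrite -mulN1r; apply: nilZ; apply: constN; exact: const1. Qed.

(** The terms of a central series for the part of bounded degree of the model:
    both bounds decrease with [k], so that deep layers are zero. *)
Definition layer m B k : set (selfmap R) :=
  [set v | exists q n, [/\ deg_below m (m - k) q, X2 q = 0, deg_below m (B - k) n
     & v = q *: X2 + n *: X1]].

Definition bounded_model m B : set (selfmap R) :=
  [set D | exists c v, [/\ F c, layer m B 0 v & D = c *: X3 + v]].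

Lemma layer_subspace m B k : subspace F (layer m B k).
Proof.
split.
- exists 0, 0; split; rewrite ?(der0 d2) //; try exact: (deg_below_zero fr).
  by rewrite !scale0r addr0.
- move=> _ _ [q [n [qf q2 nf ->]]] [q' [n' [qf' q2' nf' ->]]].
  exists (q + q'), (n + n'); split; try exact: (deg_belowD fr).
    by rewrite (derD d2) q2 q2' addr0.
  by rewrite !scalerDl addrACA.
- move=> c _ Fc [q [n [qf q2 nf ->]]].
  exists (c * q), (c * n); split; try exact: (deg_belowZ fr).
    by rewrite derZ // ?q2 ?mulr0 //; case: Fc.
  by rewrite scalerDr !scalerA.
Qed.

Lemma bounded_model_subspace m B : subspace F (bounded_model m B).
Proof.
have [L0 LD LZ] := layer_subspace m B 0; split.
- by exists 0, 0; split => //; [exact: const0|rewrite scale0r addr0].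
- move=> _ _ [c [v [Fc Lv ->]]] [c' [v' [Fc' Lv' ->]]].
  exists (c + c'), (v + v'); split; [exact: constD|exact: LD|].
  by rewrite scalerDl addrACA.
- move=> a _ Fa [c [v [Fc Lv ->]]].
  exists (a * c), (a *: v); split; [exact: constM|exact: LZ|].
  by rewrite scalerDr scalerA.
Qed.

Lemma layer_sub_bounded_model m B : layer m B 0 `<=` bounded_model m B.
Proof.
by move=> v Lv; exists 0, v; split => //; [exact: const0|rewrite scale0r add0r].
Qed.

(** Bracketing with [c *: X3] differentiates the coefficients along [X3], and
    bracketing with [q' *: X2] trades a degree at most [m - 1] of [q'] for the
    loss of [m] through [X2]. The bound [B] leaves room for the terms with [t].
    *)
Lemma bounded_model_bracket_layer m B k dt D v :
  (0 < m)%N -> deg_below m dt t -> (m + dt <= B)%N ->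
  bounded_model m B D -> layer m B k v -> layer m B k.+1 (bracket D v).
Proof.
move=> m0 tf leB [c [_ [Fc [q' [n' [qf' q2' nf' ->]]] ->]]] [q [n [qf q2 nf ->]]].
have [c1 c2 c3] := Fc.
have [q1' n1' q1 n1] := And4 qf'.1 nf'.1 qf.1 nf.1.
rewrite /ker1 /= in q1' n1' q1 n1; rewrite !subn0 in qf' nf'.
exists (c * (X3 q : R)),
  (c * (q * t + (X3 n : R)) + q' * (X2 n : R) - q * (X2 n' : R)).
split.
- by apply: (deg_belowZ fr) => //; apply: deg_below_le (deg_below_X3 fr qf); lia.
- by rewrite derZ // -(comm23 fr) // q2 (der0 d3) mulr0.
(* The products are q * t, q' * X2 n and q * X2 n'; the first two cases of mulL
   apply when a truncated bound has reached 0. *)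
- have mulL d e b x y : deg_below m d x -> deg_below m e y ->
      (d = 0 \/ e = 0 \/ d + e <= b.+1)%N -> deg_below m b (x * y).
    move=> xf yf [d0|[e0|leb]].
    + by move: xf; rewrite d0 => /deg_below0 ->; rewrite mul0r;
        exact: (deg_below_zero fr).
    + by move: yf; rewrite e0 => /deg_below0 ->; rewrite mulr0;
        exact: (deg_below_zero fr).
    + by apply: deg_below_le (deg_belowM fr xf yf); lia.
  apply: (deg_belowD fr); last first.
    by apply: (deg_belowN fr); apply: mulL qf (deg_below_X2 fr nf') _; lia.
  apply: (deg_belowD fr); last by apply: mulL qf' (deg_below_X2 fr nf) _; lia.
  apply: (deg_belowZ fr) => //; apply: (deg_belowD fr).
    by apply: mulL qf tf _; lia.
  by apply: deg_below_le (deg_below_X3 fr nf); lia.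
- apply: selfmapP => x.
  rewrite bracketE !addE !scaleE.
  rewrite !(derD d1, derD d2, derD d3, derM d1, derM d2, derM d3).
  rewrite !(frame_comm32 fr, frame_comm12 fr, frame_comm13 fr).
  rewrite c1 c2 q1 q2 q1' q2' n1 n1'.
  ring.
Qed.

End FrameAlgebra.

Section ModelNilpotent.
Variable R : fieldType.
Implicit Types (D E : selfmap R) (S : set R) (r x y : R).
Variables (X1 X2 X3 : selfmap R) (t : R).
Hypothesis fr : frame X1 X2 X3 t.
Let d1 := frame_der1 fr.
Let d2 := frame_der2 fr.
Let d3 := frame_der3 fr.
Local Notation N := (nil_functions X1 X2 X3).
Local Notation F := (joint_constants X1 X2 X3).
Local Notation M := (model X1 X2 X3).
Local Notation deg_below := (deg_below X1 X2 X3).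
Local Notation layer := (layer X1 X2 X3).
Local Notation bounded_model := (bounded_model X1 X2 X3).

(** Constant multiples of [X3] commute, so no [X3]-component and no
    undiminished coefficient can survive. *)
Lemma bounded_model_bracket m B dt D E :
  (0 < m)%N -> deg_below m dt t -> (m + dt <= B)%N ->
  bounded_model m B D -> bounded_model m B E -> layer m B 1 (bracket D E).
Proof.
move=> m0 tf leB cD cE.
have [_ LD LZ] := layer_subspace fr m B 1.
case: (cE) => [c' [v' [Fc' Lv' ->]]].
have [c [v [Fc Lv DE]]] := cD.
have -> : bracket D (c' *: X3 + v') = bracket D v' + (- c') *: bracket X3 v.
  have [c'1 c'2 c'3] := Fc'; have [c1 c2 c3] := Fc.
  have [q [n [_ _ _ vE]]] := Lv.
  apply: selfmapP => x; rewrite DE vE.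
  rewrite !(addE, scaleE, bracketE).
  rewrite !(derD d1, derD d2, derD d3, derM d1, derM d2, derM d3).
  by rewrite c'1 c'2 c'3 c3; ring.
have cX3 : bounded_model m B X3.
  exists 1, 0; split; first exact: (const1 fr).
    by have [] := layer_subspace fr m B 0.
  by rewrite scale1r addr0.
apply: LD; first exact: (bounded_model_bracket_layer fr m0 tf leB).
apply: LZ; first exact: (constN fr).
exact: (bounded_model_bracket_layer fr m0 tf leB).
Qed.

Lemma layer_mono m B k l : (k <= l)%N -> layer m B l `<=` layer m B k.
Proof.
move=> kl _ [q [n [qf q2 nf ->]]]; exists q, n.
by split => //; [apply: deg_below_le qf|apply: deg_below_le nf]; lia.
Qed.

Lemma bounded_model_sub m B : (0 < m)%N -> bounded_model m B `<=` M.
Proof.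
move=> m0 _ [c [_ [Fc [q [n [qf q2 nf ->]]] ->]]].
exists c, q, n; split => //; last by rewrite addrA.
  by split => //; apply: deg_below_nil qf.
exact: deg_below_nil nf.
Qed.

Lemma model_finite_bounded (X : set (selfmap R)) : finite_set X -> X `<=` M ->
  exists m B dt,
    [/\ (0 < m)%N, deg_below m dt t, (m + dt <= B)%N
     & X `<=` bounded_model m B].
Proof.
move=> finX XM.
(* The weight m of X2 must exceed the X3-degree of every coefficient of X2, so
   it is chosen before the weighted degrees of the coefficients of X1, which
   depend on it, are bounded. *)
pose P D k := exists c q n, [/\ F c, N q /\ X2 q = 0, N n,
  iter k X3 q = 0 & D = c *: X3 + q *: X2 + n *: X1].
have [|D /XM [c [q [n [Fc [Nq q2] Nn ->]]]]|k Pk] := @finite_uniform_bound _ X P finX.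
- move=> D k l kl [c [q [n [Fc Nq Nn qk ->]]]]; exists c, q, n; split => //.
  exact: (der_iter_ge d3 kl).
- have [_ _ [k qk]] := Nq.
  by exists k, c, q, n.
have [dt tf] := nil_deg_below fr k.+1 (frame_nil fr).
pose P' D d := exists c q n, [/\ F c, deg_below k.+1 k.+1 q /\ X2 q = 0,
  deg_below k.+1 d n
  & D = c *: X3 + q *: X2 + n *: X1].
have [|D /Pk [c [q [n [Fc [Nq q2] Nn qk ->]]]]|B PB] :=
  @finite_uniform_bound _ X P' finX.
- move=> D d e de [c [q [n [Fc Nq nf ->]]]]; exists c, q, n; split => //.
  exact: deg_below_le nf.
- have [d nf] := nil_deg_below fr k.+1 Nn.
  exists d, c, q, n; split => //; split => //; split; first by case: Nq.
  move=> i j; case: i => [|i] dij; first by apply: (der_iter_ge d3 _ qk); lia.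
  rewrite (comm_iter23 fr); last by case: Nq.
  by rewrite iterSr q2 (der_iter0 d2) (der_iter0 d3).
exists k.+1, (k.+1 + dt + B)%N, dt; split => //; first by lia.
move=> D /PB [c [q [n [Fc [qf q2] nf ->]]]].
exists c, (q *: X2 + n *: X1); split => //; last by rewrite addrA.
exists q, n; rewrite !subn0; split => //.
by apply: deg_below_le nf; lia.
Qed.

Lemma model_subspace : subspace F M.
Proof.
have N0 := nil_const (const0 fr).
split.
- exists 0, 0, 0; split => //; first exact: (const0 fr); first by rewrite (der0 d2).
  by rewrite !scale0r !addr0.
- move=> _ _ [c [q [n [Fc [Nq q2] Nn ->]]]] [c' [q' [n' [Fc' [Nq' q2'] Nn' ->]]]].
  exists (c + c'), (q + q'), (n + n'); split.
  + exact: (constD fr).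
  + by split; [exact: (nilD fr)|rewrite (derD d2) q2 q2' addr0].
  + exact: (nilD fr).
  + by rewrite !scalerDl addrACA; congr (_ + _); rewrite addrACA.
- move=> a _ Fa [c [q [n [Fc [Nq q2] Nn ->]]]].
  exists (a * c), (a * q), (a * n); split.
  + exact: (constM fr).
  + by split; [exact: (nilZ fr)|rewrite derZ // ?q2 ?mulr0 //; case: Fa].
  + exact: (nilZ fr).
  + by rewrite !scalerDr !scalerA.
Qed.

Lemma model_bracket D E : M D -> M E -> M (bracket D E).
Proof.
move=> MD ME.
have [|m [B [dt [m0 tf leB XM]]]] := @model_finite_bounded [set D; E] (finite_set2 _ _).
  by move=> _ [->|->].
apply: (bounded_model_sub m0 (B := B)); apply: layer_sub_bounded_model fr _ _ _ _.
apply: (layer_mono (leq0n 1)); apply: bounded_model_bracket m0 tf leB _ _; apply: XM.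
  by left.
by right.
Qed.

(** A finite subset of the model lies in a bounded part of it, which is a
    subalgebra; the terms of the lower central series sink into its layers. *)
Lemma model_locally_nilpotent S : S `<=` F -> locally_nilpotent S M.
Proof.
move=> SF X finX XM.
have [m [B [dt [m0 tf leB XC]]]] := model_finite_bounded finX XM.
have GC : generated_subalgebra S M X `<=` bounded_model m B.
  have subC : lie_subalgebra S M (bounded_model m B).
    split; first exact: bounded_model_sub.
      exact: subspace_sub SF (bounded_model_subspace fr m B).
    move=> E G cE cG; apply: (layer_sub_bounded_model fr).
    by apply: (layer_mono (leq0n 1)); exact: (bounded_model_bracket m0 tf leB cE cG).
  by move=> D; apply.
have lcL k : lower_central S (generated_subalgebra S M X) k.+1
    `<=` layer m B k.+1.
  elim: k => [|k IHk] /=; apply: lspan_min;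
    try exact: subspace_sub SF (layer_subspace fr m B _).
    move=> _ [D [E [/GC cD /GC cE ->]]]; exact: (bounded_model_bracket m0 tf leB cD cE).
  move=> _ [D [E [/GC cD /IHk lE ->]]]; exact: (bounded_model_bracket_layer fr m0 tf leB).
exists (m + B).+1; apply/seteqP; split => [D /lcL|_ ->].
  case=> q [n [qf _ nf ->]] /=.
  have -> : q = 0 by apply: (deg_below0 (m := m)); apply: deg_below_le qf; lia.
  have -> : n = 0 by apply: (deg_below0 (m := m)); apply: deg_below_le nf; lia.
  by rewrite !scale0r addr0.
by exists 0%N, (fun=> 0), (fun=> 0); split => [[]|[]|] //; rewrite big_ord0.
Qed.

End ModelNilpotent.

(** * Elements central modulo a subspace *)
Section LocallyNilpotent.
Variable R : fieldType.
Implicit Types (D E : selfmap R) (S : set R) (r x y : R).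

Variables (S : set R) (L : set (selfmap R)).
Hypothesis S1 : S 1.
Hypothesis L_lie : lie_subalgebra S L L.
Hypothesis L_nilp : locally_nilpotent S L.
Hypothesis L_der : forall D, L D -> is_der D.

Lemma generated_lie X : X `<=` L -> lie_subalgebra S L (generated_subalgebra S L X).
Proof.
move=> XL; split.
- by move=> D; apply.
- split.
  + by move=> M [[_ [M0 _ _] _] _].
  + move=> D E GD GE M MX; have [[_ [_ MD _] _] _] := MX.
    by apply: MD; [apply: GD|apply: GE].
  + move=> c D Sc GD M MX; have [[_ [_ _ MZ] _] _] := MX.
    by apply: MZ => //; apply: GD.
- move=> D E GD GE M MX; have [[_ _ Mb] _] := MX.
  by apply: Mb; [apply: GD|apply: GE].
Qed.

Lemma sub_generated X : X `<=` generated_subalgebra S L X.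
Proof. by move=> D XD M [_]; apply. Qed.

Lemma lower_central_sub G k :
  lie_subalgebra S L G -> lower_central S G k `<=` G.
Proof.
move=> [_ Gs Gb]; elim: k => //= k IHk; apply: lspan_min => //.
by move=> _ [D [E [GD /IHk GE ->]]]; apply: Gb.
Qed.

Lemma ad_nilpotent D E : L D -> L E -> exists k, iter k (bracket D) E = 0.
Proof.
move=> LD LE; have XL : [set D; E] `<=` L by move=> _ [->|->].
have [k lc0] := L_nilp (finite_set2 D E) XL.
exists k; suff : lower_central S (generated_subalgebra S L [set D; E]) k
    (iter k (bracket D) E) by rewrite lc0.
elim: {lc0} k => [|k IHk] /=; first by apply: sub_generated; right.
apply: sub_lspan => //; exists D, (iter k (bracket D) E); split => //.
by apply: sub_generated; left.
Qed.

(** The lower central series of the subalgebra generated by [X] starts outside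
    [U] and ends inside it: the elements outside [U] of its last term not
    contained in [U] are as required. *)
Lemma central_mod_generated (U : set (selfmap R)) X :
  U 0 -> finite_set X -> X `<=` L -> ~ (X `<=` U) ->
  exists w, [/\ L w, ~ U w & forall D, X D -> U (bracket D w)].
Proof.
move=> U0 finX XL XU; have [k lc0] := L_nilp finX XL.
have GL := generated_lie XL.
set G := generated_subalgebra S L X in lc0 GL.
have [l lU] : exists l, lower_central S G l `<=` U.
  by exists k; rewrite lc0 => _ ->.
have {l lU}[l [lU l1]] : exists l,
    lower_central S G l.+1 `<=` U /\ ~ lower_central S G l `<=` U.
  elim: l lU => [|l IHl] lU.
    by case: XU => D XD; apply: lU; apply: sub_generated.
  by have [/IHl //|nU] := pselect (lower_central S G l `<=` U); exists l.
have /existsNP[w /not_implyP[lw nUw]] := l1.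
exists w; split => //; first by have [+ _ _] := GL; apply; apply: lower_central_sub lw.
move=> D XD; apply: lU; apply: sub_lspan => //.
by exists D, w; split => //; apply: sub_generated.
Qed.

Section CentralStep.
Variables (U Y : set (selfmap R)) (n : nat) (v : 'I_n -> selfmap R).
Hypothesis subU : subspace setT U.
Hypothesis LU : forall D E, L D -> U E -> U (bracket D E).
Hypothesis L_not_U : ~ L `<=` U.
Hypothesis finY : finite_set Y.
Hypothesis YL : Y `<=` L.
Hypothesis constY : constants Y `<=` constants L.
Hypothesis Lv : L `<=` lspan setT (range v).

(** In a shortest nontrivial relation over [R], normalized to have one
    coefficient equal to 1, applying an element of [Y] to the coefficients
    gives a shorter relation. The latter is trivial, so the coefficients are
    constants. *)
Lemma constants_independent m (w : 'I_m -> selfmap R) :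
  (forall i D, Y D -> U (bracket D (w i))) ->
  (forall c : 'I_m -> R, (forall i, constants L (c i)) ->
     U (\sum_i c i *: w i) -> forall i, c i = 0) ->
  forall c : 'I_m -> R, U (\sum_i c i *: w i) -> forall i, c i = 0.
Proof.
move=> Yw indepF c; have [U0 UD UZ] := subU.
have [p] := ubnP #|[set i | c i != 0]%SET|.
elim: p c => // p IHp c ltp Uc i; apply: contrapT => /eqP ci0.
pose c' j := (c i)^-1 * c j.
have Uc' : U (\sum_j c' j *: w j).
  rewrite (eq_bigr (fun j => (c i)^-1 *: (c j *: w j))).
    by rewrite -scaler_sumr; apply: UZ.
  by move=> j _; rewrite scalerA.
have c'i : c' i = 1 by rewrite /c' mulVf.
have constc' j : constants L (c' j).
  apply: constY => D YD; have dD := L_der (YL YD).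
  apply: (IHp (fun j => D (c' j) : R)).
    move: ltp; rewrite ltnS; apply: leq_trans; apply: proper_card.
    apply/properP; split.
      apply/fintype.subsetP => l; rewrite !inE; apply: contraNneq => cl.
      by rewrite /c' cl mulr0 (der0 dD).
    by exists i; rewrite !inE // c'i (der1 dD) eqxx.
  have : U (bracket D (\sum_l c' l *: w l)) by apply: LU => //; apply: YL.
  rewrite bracket_sumr // => UDc.
  rewrite -[X in U X](addrK (\sum_l c' l *: bracket D (w l))) -scaleN1r.
  apply: UD => //; apply: UZ => //.
  by apply: (subspace_sum subU) => // l; apply: Yw.
by have /eqP := indepF c' constc' Uc' i; rewrite c'i oner_eq0.
Qed.

(** Otherwise each element central modulo [U] for a finite subset of [L] is
    moved out of [U] by some element of [L], which can be added to the subset.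
    The elements so produced are independent over the constants: in a relation
    among them, the earliest one with nonzero coefficient would have to be
    centralized by the element of [L] which moves it out of [U]. By
    [constants_independent] they are independent over [R], and there are too
    many of them. *)
Lemma central_step :
  exists w, [/\ L w, ~ U w & forall D, L D -> U (bracket D w)].
Proof.
apply: contrapT => noW; have [U0 UD UZ] := subU.
have move_out w : L w -> ~ U w -> exists2 D, L D & ~ U (bracket D w).
  move=> Lw Uw; apply: contrapT => noD; apply: noW; exists w; split => // D LD.
  by apply: contrapT => UDw; apply: noD; exists D.
have /existsNP[Z /not_implyP[LZ nUZ]] := L_not_U.
(* The initial X also contains some Z outside U, so that central_mod_generated
   applies to every X of the chain; it contains Y, so that every new element of
   the family commutes with Y modulo U. *)
have chain m : exists X (w : 'I_m -> selfmap R),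
    [/\ finite_set X, Y `<=` X, X Z & X `<=` L] /\
    [/\ forall i, L (w i), forall i D, Y D -> U (bracket D (w i))
      & forall c : 'I_m -> R, (forall i, constants L (c i)) ->
        (forall D, X D -> U (bracket D (\sum_i c i *: w i))) -> forall i, c i = 0].
  elim: m => [|m [X [w [[finX YX XZ XL] [Lw Yw indep]]]]].
    exists (Y `|` [set Z]), (fun=> 0); split; last by split => [[]|[]|c _ _ []].
    split; [by rewrite finite_setU|by left|by right|].
    by move=> D [/YL|->].
  have [|z [Lz nUz Xz]] := central_mod_generated U0 finX XL.
    by move=> /(_ _ XZ).
  have [D0 LD0 nUD0] := move_out z Lz nUz.
  exists (X `|` [set D0]),
    (fun i => if unlift ord0 i is Some j then w j else z).
  split; split.
  - by rewrite finite_setU.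
  - by move=> D /YX; left.
  - by left.
  - by move=> D [/XL|->].
  - by move=> i; case: unliftP.
  - by move=> i D YD; case: unliftP => [j _|_]; [apply: Yw|apply: Xz; apply: YX].
  move=> c Fc; rewrite big_ord_recl unlift_none.
  under eq_bigr => i _ do rewrite liftK.
  have Fz D : L D -> bracket D (c ord0 *: z) = c ord0 *: bracket D z.
    by move=> LD; rewrite bracketZr ?(Fc ord0 D) // ?scale0r ?add0r //; exact: L_der.
  move=> XD0.
  have c0 i : c (lift ord0 i) = 0.
    apply: (indep (fun i => c (lift ord0 i))) => [j|D XD]; first exact: Fc.
    have LD := XL _ XD.
    have := XD0 D (or_introl XD); rewrite bracketDr ?Fz //; last exact: L_der.
    move=> UDs; rewrite -[X in U X](addKr (c ord0 *: bracket D z)) -scaleN1r.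
    by apply: UD UDs; apply: (UZ) => //; apply: UZ => //; apply: Xz.
  move=> i; case: (unliftP ord0 i) => [j ->|->]; first exact: c0.
  apply: contrapT => /eqP c00; apply: nUD0.
  have := XD0 D0 (or_intror erefl).
  rewrite big1 => [|j _]; last by rewrite c0 scale0r.
  rewrite addr0 Fz // => Uc.
  by rewrite -[bracket D0 z](scalerK c00); apply: UZ.
have [X [w [[finX YX XZ XL] [Lw Yw indep]]]] := chain n.+1.
apply: (span_dependent (v := v) (w := w)) => [i|c _ cw0]; first exact/Lv/Lw.
apply: (constants_independent Yw); last by rewrite cw0.
move=> {cw0}c Fc Uc; apply: indep => // D XD.
by apply: LU => //; exact: XL.
Qed.

End CentralStep.

End LocallyNilpotent.

(** * The frame of a locally nilpotent algebra of rank three *)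
Section AdaptedFrame.
Variable R : fieldType.
Implicit Types (D E : selfmap R) (r x y : R).
Variables (S : set R) (L : set (selfmap R)) (v : 'I_3 -> selfmap R).
Hypothesis S1 : S 1.
Hypothesis L_lie : lie_subalgebra S L L.
Hypothesis L_nilp : locally_nilpotent S L.
Hypothesis L_der : forall D, L D -> is_der D.
Hypothesis v_indep : lin_indep setT v.
Hypothesis v_span : lspan setT L = lspan setT (range v).

Lemma L_in_span : L `<=` lspan setT (range v).
Proof. by rewrite -v_span; apply: sub_lspan. Qed.

(** Each vector of an [R]-basis of the span of [L] involves finitely many
    elements of [L], and these together have the same constants as [L]. *)
Lemma finite_spanning_subset :
  exists Y, [/\ finite_set Y, Y `<=` L & constants Y `<=` constants L].
Proof.
have /choice[Y vY] : forall i : 'I_3, exists Y : set (selfmap R),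
    [/\ finite_set Y, Y `<=` L & lspan setT Y (v i)].
  move=> i; have : lspan setT L (v i).
    by rewrite v_span; apply: sub_lspan => //; exists i.
  case=> n [c [x [_ Lx vE]]]; exists (range x); split.
  - by apply: finite_image; exact: finite_finset.
  - by move=> _ [j _ <-].
  - by exists n, c, x; split => // j; exists j.
have kill_sub r : subspace setT [set D : selfmap R | D r = 0].
  split => //= [D E Dr Er|c D _ Dr].
    by rewrite addE Dr Er addr0.
  by rewrite scaleE Dr mulr0.
exists (\bigcup_i Y i); split.
- by apply: bigcup_finite => [|i _]; [exact: finite_finset|have [] := vY i].
- by move=> D [i _ YD]; have [_ + _] := vY i; apply.
- move=> r Yr D LD; apply: (lspan_min (kill_sub r)) (L_in_span LD).
  move=> _ [i _ <-]; have [_ _] := vY i; apply: lspan_min => // E YE.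
  by apply: Yr; exists i.
Qed.

Lemma plane_stable X Y :
  (forall D, L D -> plane X Y (bracket D X)) ->
  (forall D, L D -> plane X Y (bracket D Y)) ->
  forall D E, L D -> plane X Y E -> plane X Y (bracket D E).
Proof.
move=> PX PY D _ LD [r [s ->]]; have dD := L_der LD.
have [_ PD PZ] := plane_subspace X Y.
rewrite bracketDr // !bracketZr //.
by apply: (PD); apply: PD; try (by apply: PZ => //; apply: PX);
  try (by apply: PZ => //; apply: PY); apply: PZ => //;
  [exists 1, 0|exists 0, 1]; rewrite scale1r scale0r ?addr0 ?add0r.
Qed.

Lemma plane_step X Y :
  (forall D, L D -> plane X Y (bracket D X)) ->
  (forall D, L D -> plane X Y (bracket D Y)) ->
  exists Z, [/\ L Z, ~ plane X Y Z & forall D, L D -> plane X Y (bracket D Z)].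
Proof.
move=> PX PY; have [Y0 [finY YL constY]] := finite_spanning_subset.
have subP := plane_subspace X Y.
apply: (central_step S1 L_lie L_nilp L_der subP (plane_stable PX PY) _
  finY YL constY L_in_span) => LP.
apply: (plane_not_span (X := X) (Y := Y) v_indep) => D vD.
apply: (lspan_min subP LP); rewrite v_span; exact: sub_lspan.
Qed.

Definition independent3 (X1 X2 X3 : selfmap R) : Prop :=
  forall r1 r2 r3 : R, r1 *: X1 + r2 *: X2 + r3 *: X3 = 0 ->
    [/\ r1 = 0, r2 = 0 & r3 = 0].

Lemma adapted_flag : exists X1 X2 X3,
  [/\ [/\ L X1, L X2 & L X3], independent3 X1 X2 X3,
      forall D, L D -> exists r1 r2 r3 : R, D = r1 *: X1 + r2 *: X2 + r3 *: X3
    & [/\ forall D, L D -> bracket D X1 = 0,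
          forall D, L D -> exists s : R, bracket D X2 = s *: X1
        & forall D, L D -> plane X1 X2 (bracket D X3)]].
Proof.
have b0 D : L D -> bracket D 0 = 0 by move=> /L_der; apply: bracket0r.
have P0 X Y : plane X Y 0 by have [] := plane_subspace X Y.
have [||X1 [LX1 nX1 bX1]] := @plane_step 0 0; try by move=> D /b0 ->.
have {}bX1 D : L D -> bracket D X1 = 0.
  by move=> /bX1[r [s ->]]; rewrite !scaler0 addr0.
have [||X2 [LX2 nX2 bX2]] := @plane_step X1 0.
- by move=> D /bX1 ->.
- by move=> D /b0 ->.
have [||X3 [LX3 nX3 bX3]] := @plane_step X1 X2.
- by move=> D /bX1 ->.
- by move=> D /bX2[r [s ->]]; exists r, 0; rewrite scaler0 scale0r.
have indep : independent3 X1 X2 X3.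
  move=> r1 r2 r3 eq0.
  have r30 : r3 = 0.
    apply: contrapT => /eqP r30; apply: nX3.
    exists (- r3^-1 * r1), (- r3^-1 * r2); rewrite -!scalerA -scalerDr.
    exact: scale_solve eq0.
  move: eq0; rewrite r30 scale0r addr0 => eq0.
  have r20 : r2 = 0.
    apply: contrapT => /eqP r20; apply: nX2.
    exists (- r2^-1 * r1), 0; rewrite scale0r addr0 -!scalerA.
    exact: scale_solve eq0.
  move: eq0; rewrite r20 scale0r addr0 => eq0; split => //.
  apply: contrapT => /eqP r10; apply: nX1; exists 0, 0.
  by rewrite !scaler0 addr0 -(scalerK r10 X1) eq0 scaler0.
exists X1, X2, X3; split => //; last first.
  by split => // D /bX2[r [s ->]]; exists r; rewrite scaler0 addr0.
move=> D LD; apply: contrapT => noD.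
(* Four vectors in a space of dimension three: the relation between them has a
   nonzero coefficient at D by the independence of the flag. *)
pose w (i : 'I_4) := nth (0 : selfmap R) [:: X1; X2; X3; D] i.
apply: (span_dependent (v := v) (w := w)) => [i|c _].
  apply: L_in_span; rewrite /w; case: i => -[|[|[|[|//]]]] //=.
rewrite !big_ord_recl big_ord0 /w /= addr0.
set c1 := c _; set c2 := c _; set c3 := c _; set c4 := c _.
rewrite !addrA => eq0.
have c40 : c4 = 0.
  apply: contrapT => /eqP c40; apply: noD.
  exists (- c4^-1 * c1), (- c4^-1 * c2), (- c4^-1 * c3).
  by rewrite -!scalerA -!scalerDr; apply: scale_solve eq0.
move: eq0; rewrite c40 scale0r addr0 => /indep[c10 c20 c30].
case=> -[|[|[|[|//]]]] lt_i4; [rewrite -[RHS]c10|rewrite -[RHS]c20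
  |rewrite -[RHS]c30|rewrite -[RHS]c40]; congr c; exact: val_inj.
Qed.

Lemma nilpotent_atB E x y : is_der E ->
  nilpotent_at E x -> nilpotent_at E y -> nilpotent_at E (x - y).
Proof.
move=> dE [k xk] [l yl]; exists (maxn k l).
rewrite -mulN1r der_iterD // der_iterZ //; last by rewrite derN // der1 // oppr0.
by rewrite (der_iter_ge dE _ xk) ?(der_iter_ge dE _ yl) ?leq_maxl ?leq_maxr //
  mulr0 addr0.
Qed.

Lemma iter_bracket E X k r : is_der E -> bracket E X = 0 ->
  iter k (bracket E) (r *: X) = (iter k E r : R) *: X.
Proof.
by move=> dE EX; elim: k => //= k ->; rewrite bracketZr // EX scaler0 addr0.
Qed.

(** The frame is the adapted flag. For [D = r1 X1 + r2 X2 + r3 X3] in [L], the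
    position of the brackets of [D] with [X1], [X2], [X3] relative to the flag
    forces [r3] to be a constant, [X2 r2 = 0] and [X1 r1 = X1 r2 = 0]. Since
    [X2] and [X3] act nilpotently on [L] by brackets, they act nilpotently on
    [r1] and [r2]. *)
Lemma adapted_frame : exists X1 X2 X3 t,
  [/\ [/\ L X1, L X2 & L X3], independent3 X1 X2 X3, frame X1 X2 X3 t,
      constants L = joint_constants X1 X2 X3 & L `<=` model X1 X2 X3].
Proof.
have [X1 [X2 [X3 [[L1 L2 L3] indep span [b1 b2 b3]]]]] := adapted_flag.
have [_ subL Lb] := L_lie.
have [d1 d2 d3] := And3 (L_der L1) (L_der L2) (L_der L3).
have [t b32] := b2 _ L3.
have X1inj (r s : R) : r *: X1 = s *: X1 -> r = s.
  move=> rs; have [//|+ _ _] := indep (r - s) 0 0.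
    by rewrite !scale0r !addr0 scalerBl rs subrr.
  by move/eqP; rewrite subr_eq0 => /eqP.
have b1' D : L D -> bracket X1 D = 0 by move=> LD; rewrite bracketC b1 // oppr0.
have coord_uniq (r1 r2 r3 s1 s2 s3 : R) :
    r1 *: X1 + r2 *: X2 + r3 *: X3 = s1 *: X1 + s2 *: X2 + s3 *: X3 ->
    [/\ r1 = s1, r2 = s2 & r3 = s3].
  move=> rs; have [|/eqP + /eqP + /eqP +] := indep (r1 - s1) (r2 - s2) (r3 - s3).
    by rewrite -(subrr (s1 *: X1 + s2 *: X2 + s3 *: X3)) -{1}rs; pointwise.
  by rewrite !subr_eq0 => /eqP-> /eqP-> /eqP->.
have b0 : 0 = 0 *: X1 + 0 *: X2 + 0 *: X3 by rewrite !scale0r !addr0.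
have coords (D : selfmap R) (r1 r2 r3 : R) : L D ->
    D = r1 *: X1 + r2 *: X2 + r3 *: X3 ->
  [/\ [/\ X1 r1 = 0, X1 r2 = 0 & X1 r3 = 0], X2 r2 = 0, X2 r3 = 0 /\ X3 r3 = 0,
    bracket X2 D = ((X2 r1 : R) - r3 * t) *: X1
    & bracket X3 D = ((X3 r1 : R) + r2 * t) *: X1 + (X3 r2 : R) *: X2].
  move=> LD DE.
  have exp E : is_der E -> bracket E D = (E r1 : R) *: X1 + (E r2 : R) *: X2
      + (E r3 : R) *: X3
      + (r1 *: bracket E X1 + r2 *: bracket E X2 + r3 *: bracket E X3).
    move=> dE; rewrite DE !bracketDr // !bracketZr //.
    by pointwise.
  have := exp X1 d1; rewrite !b1' // !scaler0 !addr0 => e1.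
  have {e1 b0}[x11 x12 x13] := coord_uniq _ _ _ _ _ _ (etrans (esym b0) e1).
  have b23 : bracket X2 X3 = - t *: X1 by rewrite bracketC b32 scaleNr.
  have [s b2D] := b2 D LD.
  have {}e2 : bracket X2 D = ((X2 r1 : R) - r3 * t) *: X1 + (X2 r2 : R) *: X2
      + (X2 r3 : R) *: X3.
    rewrite (exp X2 d2) b1 // bracketDD b23 !scaler0 !add0r scalerA mulrN.
    by pointwise.
  have : - s *: X1 + 0 *: X2 + 0 *: X3 = bracket X2 D.
    by rewrite bracketC b2D scaleNr !scale0r !addr0.
  rewrite e2 => /coord_uniq[_ x22 x23].
  have [s1 [s2 b3D]] := b3 D LD.
  have e3 : bracket X3 D = ((X3 r1 : R) + r2 * t) *: X1 + (X3 r2 : R) *: X2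
      + (X3 r3 : R) *: X3.
    rewrite (exp X3 d3) b1 // bracketDD b32 !scaler0 add0r addr0 scalerA.
    by pointwise.
  have : - s1 *: X1 + - s2 *: X2 + 0 *: X3 = bracket X3 D.
    by rewrite bracketC b3D !scaleNr scale0r addr0 opprD.
  rewrite e3 => /coord_uniq[_ _ x33].
  split; rewrite -?x11 -?x12 -?x13 -?x22 -?x23 -?x33 //.
    by rewrite ?e2 -?x22 -?x23 !scale0r !addr0.
  by rewrite ?e3 -?x33 scale0r addr0.
have nil1 r : L (r *: X1) -> nil_functions X1 X2 X3 r.
  move=> Lr; have rE : r *: X1 = r *: X1 + 0 *: X2 + 0 *: X3.
    by rewrite !scale0r !addr0.
  have [[x1r _ _] _ _ _ _] := coords _ _ _ _ Lr rE.
  have nilat E : L E -> nilpotent_at E r.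
    move=> LE; have [k] := ad_nilpotent S1 L_nilp LE Lr.
    rewrite iter_bracket ?b1 //; last exact: L_der.
    by rewrite -(scale0r X1) => /X1inj; exists k.
  by split => //; apply: nilat.
have fr : frame X1 X2 X3 t.
  have commE D E x : bracket D E = 0 -> D (E x) = E (D x) :> R.
    by move=> /(congr1 (fun G : selfmap R => G x)) /eqP; rewrite subr_eq0 => /eqP.
  split=> // [x|x|x|].
  - exact: (commE X1 X2 x (b1' _ L2)).
  - exact: (commE X1 X3 x (b1' _ L3)).
  - have := congr1 (fun G : selfmap R => G x : R) b32.
    by rewrite bracketE scaleE => <-; rewrite addrC subrK.
  - by apply: nil1; rewrite -b32; apply: Lb.
have FL : constants L = joint_constants X1 X2 X3.
  apply/seteqP; split=> [r Lr|r [r1 r2 r3] D LD]; first by split; apply: Lr.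
  have [s1 [s2 [s3 ->]]] := span D LD.
  by rewrite !(addE, scaleE) r1 r2 r3 !mulr0 !addr0.
exists X1, X2, X3, t; split => // D LD.
have [r1 [r2 [r3 DE]]] := span D LD.
have [[x11 x12 x13] x22 [x23 x33] b2D b3D] := coords D r1 r2 r3 LD DE.
have Fr3 : joint_constants X1 X2 X3 r3 by [].
have [k bk] := ad_nilpotent S1 L_nilp L3 LD.
have nil_t := frame_nil fr.
have b3plane (q n : R) :
    bracket X3 (n *: X1 + q *: X2) = ((X3 n : R) + q * t) *: X1 + (X3 q : R) *: X2.
  by rewrite bracketDr // !bracketZr // b1 // b32 scaler0 addr0; pointwise.
(* Up to the term q * t, which is a nil function as soon as q is one, ad X3 acts
   on n *: X1 + q *: X2 as X3 on the coefficients. *)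
have descend l : forall q n : R, X1 q = 0 -> X1 n = 0 ->
    iter l (bracket X3) (n *: X1 + q *: X2) = 0 ->
    iter l X3 q = 0 :> R /\
    (nil_functions X1 X2 X3 q -> nilpotent_at X3 n).
  elim: l => [|l IHl] q n q1 n1; last rewrite !iterSr b3plane //.
    move=> /= nq0; have [|-> -> _] := indep n q 0.
      by rewrite scale0r addr0.
    by split => // _; exists 0%N.
  have q1' := ker1_X3 fr q1; have n1' := ker1_X3 fr n1; have [t1 _ _] := nil_t.
  move=> /IHl[||-> nilN]; first by [].
    by rewrite (derD d1) (derM d1) n1' q1 t1 mul0r mulr0 !addr0.
  split => // Nq; have [m nm] := nilN (nil_X3 fr Nq).
  have [_ _ nil_qt] := nilM fr Nq nil_t.
  have [] := nilpotent_atB d3 (ex_intro _ m nm) nil_qt.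
  by rewrite addrK => p np; exists p.+1; rewrite iterSr.
have [|iter_r2 nil_r1] := descend k.+1 _ _ x12 x11.
  by rewrite iterSr b3plane // -b3D -iterSr iterS bk bracket0r.
have Nr2 : nil_functions X1 X2 X3 r2.
  by split => //; [exists 1%N|exists k.+1].
have X2r1 : nil_functions X1 X2 X3 (X2 r1).
  have := Lb _ _ L2 LD; rewrite b2D => /nil1 N1.
  have := nilD fr N1 (nilZ fr Fr3 nil_t); by rewrite subrK.
exists r3, r2, r1; split => //; last by rewrite DE; pointwise.
split => //.
- have [_ [l X2l] _] := X2r1; exists l.+1; by rewrite iterSr.
- exact: nil_r1.
Qed.
End AdaptedFrame.

(** * Slices and divided powers *)
Section Slices.
Variable R : fieldType.
Implicit Types (D : selfmap R) (r x y : R).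

Lemma last_nonzero D r : nilpotent_at D r -> r != 0 ->
  exists j, iter j D r != 0 :> R /\ D (iter j D r) = 0.
Proof.
case=> k; elim: k => [/= -> /eqP //|k IHk] rk r0.
have [/eqP rk0|rk0] := boolP (iter k D r == 0 :> R); first exact: IHk.
by exists k.
Qed.

(** When the second derivative of [y] vanishes and the first one does not, [y]
    divided by its derivative is a slice of [D]. *)
Lemma last_nonconstant D r : is_der D -> nilpotent_at D r -> D r != 0 :> R ->
  exists j, D (iter j D r) != 0 :> R /\ D (D (iter j D r)) = 0.
Proof.
move=> dD [k rk] Dr0; have [|j [j0 j1]] := @last_nonzero D (D r) _ Dr0.
  by case: k rk => [/= r0|k]; [exists 0%N; rewrite /= r0 der0|rewrite iterSr; exists k].
by exists j; rewrite -iterS iterSr.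
Qed.

(** Induction on the order of nilpotency: an element of [N] differs from an
    antiderivative, in [P], of its derivative by an element of the kernel. *)
Lemma nilpotent_sub_of_antiderivatives (D : selfmap R) (N P : set R) :
  is_der D ->
  (forall x, N x -> N (D x)) -> (forall x y, N x -> N y -> N (x - y)) ->
  (forall x y, P x -> P y -> P (x + y)) -> P `<=` N ->
  (forall p, P p -> exists2 s, P s & D s = p) ->
  (forall x, N x -> D x = 0 -> P x) ->
  (forall x, N x -> nilpotent_at D x) -> N `<=` P.
Proof.
move=> dD ND NB PD PN Pint P0 Nnil x Nx; have [k] := Nnil x Nx.
elim: k x Nx => [x Nx /= x0|k IHk x Nx]; first by apply: P0; rewrite // x0 der0.
rewrite iterSr => /(IHk _ (ND _ Nx))/Pint[s Ps Ds].
rewrite -(subrK s x); apply: PD => //; apply: P0; first exact: NB (PN _ Ps).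
by rewrite derB // Ds subrr.
Qed.

Lemma antiderivative_span (S : set R) (I : Type) (g g' : I -> R) D :
  is_der D -> (forall c, S c -> D c = 0) -> (forall i, D (g' i) = g i :> R) ->
  forall p, lspan S (range g : set R^o) p ->
  exists2 s, lspan S (range g' : set R^o) s & D s = p.
Proof.
move=> dD DS Dg p [n [c [x [Sc xg ->]]]].
have /choice[i xi] : forall j, exists i, g i = x j.
  by move=> j; have [i _ <-] := xg j; exists i.
exists (\sum_j c j * g' (i j)).
  by exists n, c, (g' \o i); split => // j; exists (i j).
rewrite der_sum //; apply: eq_bigr => j _; rewrite derZ ?Dg ?xi //; exact: DS.
Qed.

Lemma lspan_scale (S : set R) (I : Type) (g : I -> R) (G : set (selfmap R)) X :
  subspace S G -> (forall i, G (g i *: X)) ->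
  forall p, lspan S (range g : set R^o) p -> G (p *: X).
Proof.
move=> subG gG p [n [c [x [Sc xg ->]]]].
rewrite scaler_suml; under eq_bigr => i _ do rewrite -scalerA.
by apply: (subspace_sum subG) => // i; have [j _ <-] := xg i.
Qed.

Hypothesis char0 : forall n, n.+1%:R != 0 :> R.

Lemma der_nat D n : is_der D -> D n%:R = 0 :> R.
Proof.
by move=> dD; elim: n => [|n IHn]; rewrite ?der0 // mulrS derD // der1 // IHn addr0.
Qed.

Lemma der_exp D a n : is_der D ->
  D (a ^+ n.+1) = n.+1%:R * a ^+ n * (D a : R) :> R.
Proof.
move=> dD; elim: n => [|n IHn]; first by rewrite expr1 expr0 !mul1r.
by rewrite exprS derM // IHn [in RHS]mulrS [a ^+ n.+1]exprS; ring.
Qed.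

Lemma der_dpow0 D a i : is_der D -> D a = 0 -> D (dpow a i) = 0 :> R.
Proof.
move=> dD Da; rewrite /dpow (derM dD) (derV dD) ?(der_nat _ dD) // mulr0 addr0.
by case: i => [|i]; rewrite ?expr0 ?(der1 dD) // ?(der_exp _ _ dD) // ?Da ?mulr0 mul0r.
Qed.

Lemma der_dpow D a i : is_der D -> D a = 1 -> D (dpow a i.+1) = dpow a i :> R.
Proof.
move=> dD Da; rewrite /dpow (derM dD) (derV dD) ?(der_nat _ dD) // mulr0 addr0.
rewrite (der_exp _ _ dD) Da mulr1 factS natrM invfM mulrACA divff ?mul1r //.
Qed.

End Slices.

(** * Changing the frame *)
Section FrameChanges.
Variable R : fieldType.
Implicit Types (D E : selfmap R) (S : set R) (r x y : R).
Variables (X1 X2 X3 : selfmap R) (t : R).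
Hypothesis fr : frame X1 X2 X3 t.
Let d1 := frame_der1 fr.
Let d2 := frame_der2 fr.
Let d3 := frame_der3 fr.
Local Notation N := (nil_functions X1 X2 X3).
Local Notation F := (joint_constants X1 X2 X3).
Local Notation M := (model X1 X2 X3).

Lemma nilB x y : N x -> N y -> N (x - y).
Proof. by move=> Nx Ny; apply: (nilD fr) => //; apply: (nilN fr). Qed.

Lemma nil_iter2 k x : N x -> N (iter k X2 x).
Proof. by move=> Nx; elim: k => //= k; apply: (nil_X2 fr). Qed.

Lemma nil_iter3 k x : N x -> N (iter k X3 x).
Proof. by move=> Nx; elim: k => //= k; apply: (nil_X3 fr). Qed.

Lemma constV c : F c -> F c^-1.
Proof. by move=> [c1 c2 c3]; split; apply: derV. Qed.

Lemma nil_ker1 x : N x -> X1 x = 0 :> R. Proof. by case. Qed.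

Lemma comm_nil x : N x -> X3 (X2 x) = X2 (X3 x).
Proof. by move=> /nil_ker1; apply: (comm23 fr). Qed.

Lemma model_scale_X1 n : N n -> M (n *: X1).
Proof.
move=> Nn; exists 0, 0, n; split => //; first exact: (const0 fr).
  by split; [exact/nil_const/(const0 fr)|rewrite (der0 d2)].
by rewrite !scale0r !add0r.
Qed.

Lemma model_scale_X2 q : N q -> X2 q = 0 -> M (q *: X2).
Proof.
move=> Nq q2; exists 0, q, 0; split => //; first exact: (const0 fr).
  exact/nil_const/(const0 fr).
by rewrite !scale0r add0r addr0.
Qed.

Lemma model_X3 : M X3.
Proof.
have N0 := nil_const (const0 fr).
exists 1, 0, 0; split => //; first exact: (const1 fr).
  by rewrite (der0 d2).
by rewrite !scale0r scale1r !addr0.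
Qed.

Lemma model_X1 : M X1.
Proof. by have := model_scale_X1 (nil_const (const1 fr)); rewrite scale1r. Qed.

Lemma model_X2 : M X2.
Proof.
by have := model_scale_X2 (nil_const (const1 fr)) (der1 d2); rewrite scale1r.
Qed.

Lemma model_min G : subspace F G -> G X3 ->
  (forall q, N q -> X2 q = 0 -> G (q *: X2)) ->
  (forall n, N n -> G (n *: X1)) -> M `<=` G.
Proof.
move=> [_ GD GZ] G3 G2 G1 _ [c [q [n [Fc [Nq q2] Nn ->]]]].
by apply: (GD); [apply: GD; [exact: GZ|exact: G2]|exact: G1].
Qed.

Section Shear.
Variable s : R.
Hypotheses (Ns : N s) (X3s : X3 s = t).
Local Notation X2' := (X2 - s *: X1).

Lemma shearedE x : X1 x = 0 -> X2' x = X2 x.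
Proof. by move=> x1; rewrite addE oppE scaleE x1 mulr0 subr0. Qed.

Lemma sheared_iter k x : X1 x = 0 -> iter k X2' x = iter k X2 x :> R.
Proof.
by move=> x1; elim: k => //= k ->; rewrite shearedE //; apply: (ker1_iter2 fr).
Qed.

Lemma sheared_nil : nil_functions X1 X2' X3 = N.
Proof.
by apply/seteqP; split => x [x1 [k xk] x3]; split => //; exists k;
  move: xk; rewrite sheared_iter.
Qed.

Lemma sheared_const : joint_constants X1 X2' X3 = F.
Proof.
by apply/seteqP; split => x [x1 x2 x3]; split => //; move: x2; rewrite shearedE.
Qed.

(** Subtracting from [X2] the multiple of [X1] by a nil function changes
    nothing on the functions killed by [X1], hence neither the nil functions
    nor the model; it removes [t] from the bracket as soon as [t] has an
    antiderivative along [X3]. *)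
Lemma sheared_frame : frame X1 X2' X3 0.
Proof.
have [s1 _ _] := Ns.
split => //.
- by apply: is_derD => //; rewrite -scaleN1r; do 2 apply: is_derZ.
- move=> x; rewrite !(addE, oppE, scaleE) (derB d1) (derM d1) s1 mul0r add0r.
  by rewrite (frame_comm12 fr).
- exact: (frame_comm13 fr).
- move=> x; rewrite !(addE, oppE, scaleE) (derB d3) (derM d3) X3s.
  by rewrite (frame_comm32 fr) (frame_comm13 fr); ring.
- by rewrite sheared_nil; apply/nil_const/(const0 fr).
Qed.

Lemma sheared_model : model X1 X2' X3 = M.
Proof.
apply/seteqP; split=> _ [c [q [n [Fc [Nq q2] Nn ->]]]].
  rewrite sheared_nil sheared_const in Fc Nq Nn.
  have [q1 _ _] := Nq; rewrite shearedE // in q2.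
  exists c, q, (n - q * s); split => //; last by pointwise.
  by apply: nilB => //; apply: (nilM fr).
exists c, q, (n + q * s); rewrite sheared_nil sheared_const.
split => //; last by pointwise.
  by split => //; rewrite shearedE //; case: Nq.
by apply: (nilD fr) => //; apply: (nilM fr).
Qed.

End Shear.

(** A nonconstant nil function killed by [X2] is not killed by [X3]; dividing
    its last nonconstant iterate under [X3] by the derivative gives a slice. *)
Lemma constants_or_first_slice :
  (forall q, N q -> X2 q = 0 -> F q) \/
  exists a, [/\ N a, X2 a = 0 & X3 a = 1].
Proof.
have [?|/existsNP[q /not_implyP[Nq /not_implyP[q2 nFq]]]] :=
  pselect (forall q, N q -> X2 q = 0 -> F q); [by left|right].
have [q1 _ q3] := Nq.
have [|j [y0 y3]] := last_nonconstant d3 q3.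
  by apply/eqP => q30; apply: nFq.
set y := iter j X3 q in y0 y3.
have Ny : N y by apply: nil_iter3.
have y2 : X2 y = 0 by rewrite -(comm_iter3 fr) // q2 (der_iter0 d3).
have Fe : F (X3 y).
  have Ne := nil_X3 fr Ny; split => //; first exact: nil_ker1.
  by rewrite -comm_nil // y2 (der0 d3).
exists ((X3 y : R)^-1 * y).
have [_ e2 e3] := constV Fe.
split; first exact: (nilZ fr (constV Fe) Ny).
  by rewrite (derZ d2) // y2 mulr0.
by rewrite (derZ d3) // mulVf.
Qed.

(** Every nil function killed by [X2] is constant, so that a nonconstant one
    leads to a slice [b] of [X2], and [c = X3 b] is a constant. Then [X3 - c *:
    X2] kills [b], and the derivations [X3 - c *: X2] and [X2] can play the
    parts of [X2] and [X3]: in the new frame [b] is a slice of the third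
    derivation, killed by the second. *)
Lemma exchange_frame : (forall q, N q -> X2 q = 0 -> F q) -> ~ N `<=` F ->
  exists c b, F c /\ [/\ frame X1 (X3 - c *: X2) X2 (- t),
    M `<=` model X1 (X3 - c *: X2) X2,
    nil_functions X1 (X3 - c *: X2) X2 b, (X3 - c *: X2) b = 0 & X2 b = 1].
Proof.
move=> QF /existsNP[n /not_implyP[Nn nFn]].
have [n1 n2 _] := Nn.
have [|j [y0 y2]] := last_nonconstant d2 n2.
  by apply/eqP => n20; apply: nFn; apply: QF.
set y := iter j X2 n in y0 y2.
have Ny : N y by apply: nil_iter2.
have Fe : F (X2 y) by apply: QF => //; exact: (nil_X2 fr).
have [e1 e2 e3] := constV Fe.
set b := (X2 y : R)^-1 * y.
have Nb : N b := nilZ fr (constV Fe) Ny.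
have b2 : X2 b = 1 by rewrite (derZ d2) // mulVf.
have Fc : F (X3 b).
  by apply: QF; [exact: (nil_X3 fr)|rewrite -comm_nil // b2 (der1 d3)].
exists (X3 b), b; split => //.
set c := X3 b in Fc *; have [c1 c2 c3] := Fc.
(* Nilpotency of X3 - c *: X2 on N: with the weight m = 1 for X2, both of its
   terms lower the degree by at least 1. *)
have NN' : N `<=` nil_functions X1 (X3 - c *: X2) X2.
  move=> x Nx; have [x1 x2 _] := Nx; split => //.
  have [d xd] := nil_deg_below fr 1 Nx; exists d.
  elim: d x xd {Nx x1 x2} => [|d IHd] x xd; first exact: deg_below0 xd.
  rewrite iterSr; apply: IHd; rewrite addE oppE scaleE.
  apply: (deg_belowD fr); first exact: (deg_below_X3 fr) xd.
  apply: (deg_belowN fr); apply: (deg_belowZ fr) => //.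
  by have := deg_below_X2 fr xd; rewrite subn1.
have F' x : F x -> joint_constants X1 (X3 - c *: X2) X2 x.
  by move=> [x1 x2 x3]; split => //; rewrite addE oppE scaleE x2 x3 mulr0 subr0.
split => //; last 2 first.
- exact: NN'.
- by rewrite addE oppE scaleE b2 mulr1 subrr.
- split => //.
  + by apply: is_derD => //; rewrite -scaleN1r; do 2 apply: is_derZ.
  + move=> x; rewrite !(addE, oppE, scaleE) (derB d1) (derZ d1) //.
    by rewrite (frame_comm12 fr) (frame_comm13 fr).
  + exact: (frame_comm12 fr).
  + move=> x; rewrite !(addE, oppE, scaleE) (derB d2) (derZ d2) //.
    by rewrite (frame_comm32 fr); ring.
  + by apply: NN'; apply: (nilN fr); exact: (frame_nil fr).
- move=> _ [c' [q [p [Fc' [Nq q2] Np ->]]]].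
  exists (q + c' * c), c', p; split; last by pointwise.
  + by apply: F'; apply: (constD fr); [exact: QF|exact: (constM fr)].
  + split; first exact/NN'/nil_const.
    by have [_ + _] := F' _ Fc'.
  + exact: NN'.
Qed.

End FrameChanges.

(** * The three types of models *)
Section Types.
Variable R : fieldType.
Implicit Types (D E : selfmap R) (S : set R) (r x y : R).
Hypothesis char0 : forall n, n.+1%:R != 0 :> R.

Lemma constants_model (X1 X2 X3 : selfmap R) t : frame X1 X2 X3 t ->
  constants (model X1 X2 X3) = joint_constants X1 X2 X3.
Proof.
move=> fr; apply/seteqP; split=> [r Mr|r [r1 r2 r3] _ [c [q [n [_ _ _ ->]]]]].
  by split; apply: Mr; [exact: model_X1 fr|exact: model_X2 fr|exact: model_X3 fr].
by rewrite !(addE, scaleE) r1 r2 r3 !mulr0 !addr0.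
Qed.

(** Only [X3] and [X2] fail to commute, and their bracket is a constant
    multiple of the central element [X1]. *)
Lemma model_type1 (X1 X2 X3 : selfmap R) t :
  frame X1 X2 X3 t -> independent3 X1 X2 X3 ->
  nil_functions X1 X2 X3 `<=` joint_constants X1 X2 X3 ->
  type1 (model X1 X2 X3).
Proof.
move=> fr indep NF; set F : set R := joint_constants X1 X2 X3.
have FM : constants (model X1 X2 X3) = F := constants_model fr.
have subM := model_subspace fr.
rewrite /type1 FM; split; last first.
  exists (fun i : 'I_3 => nth X1 [:: X1; X2; X3] i); split.
    move=> c Fc; rewrite !big_ord_recl big_ord0 /= addr0 addrA.
    move=> /indep[c1 c2 c3]; case=> -[|[|[|//]]] lt_i3;
      [rewrite -[RHS]c1|rewrite -[RHS]c2|rewrite -[RHS]c3];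
      congr c; exact: val_inj.
  apply/seteqP; split=> [D [c [q [n [Fc [/NF Fq _] /NF Fn ->]]]]|].
    exists 3%N, (fun i : 'I_3 => nth 0 [:: n; q; c] i),
      (fun i : 'I_3 => nth X1 [:: X1; X2; X3] i); split => //.
      by case=> -[|[|[|//]]].
    by rewrite !big_ord_recl big_ord0 /= addr0; pointwise.
  apply: lspan_min => // _ [i _ <-]; case: i => -[|[|[|//]]] _ /=.
  - exact: model_X1 fr.
  - exact: model_X2 fr.
  - exact: model_X3 fr.
have [d1 d2 d3] := And3 (frame_der1 fr) (frame_der2 fr) (frame_der3 fr).
have [F0 FD FZ] : subspace F [set D : selfmap R | exists2 f, F f & D = f *: X1].
  split; first by exists 0; [exact: const0 fr|rewrite scale0r].
    move=> _ _ [f Ff ->] [g Fg ->]; exists (f + g); last by rewrite scalerDl.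
    exact: (constD fr).
  move=> c _ Fc [f Ff ->]; exists (c * f); last by rewrite scalerA.
  exact: (constM fr).
have bracket_M (c q n c' q' n' : R) : F c -> F q -> F n -> F c' -> F q' -> F n' ->
    bracket (c *: X3 + q *: X2 + n *: X1) (c' *: X3 + q' *: X2 + n' *: X1)
    = ((c * q' - q * c') * t) *: X1.
  move=> [c1 c2 c3] [q1 q2 q3] [n1 n2 n3] [c1' c2' c3'] [q1' q2' q3'] [n1' n2' n3'].
  apply: selfmapP => x; rewrite !(bracketE, addE, scaleE).
  rewrite !(derD d1, derD d2, derD d3, derM d1, derM d2, derM d3).
  rewrite !(frame_comm32 fr, frame_comm12 fr, frame_comm13 fr).
  rewrite c1 c2 c3 q1 q2 q3 n1 n2 n3 c1' c2' c3' q1' q2' q3' n1' n2' n3'; ring.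
have Ft : F t by apply: NF; exact: frame_nil fr.
have lc1 : lower_central F (model X1 X2 X3) 1 `<=`
    [set D : selfmap R | exists2 f, F f & D = f *: X1].
  apply: lspan_min => // _ [_ [_ [[c [q [n [Fc [/NF Fq _] /NF Fn ->]]]]
    [c' [q' [n' [Fc' [/NF Fq' _] /NF Fn' ->]]]] ->]]].
  rewrite bracket_M //; exists ((c * q' - q * c') * t) => //.
  apply: (constM fr) => //; apply: (constD fr); first exact: (constM fr).
  by apply: (constN fr); apply: (constM fr).
exists 2%N; apply/seteqP; split => [|_ ->]; last first.
  by exists 0%N, (fun=> 0), (fun=> 0); split => [[]|[]|] //; rewrite big_ord0.
apply: lspan_min; first by split => [//|u v /= -> ->|c v _ /= ->];
  rewrite ?addr0 ?scaler0.
move=> _ [_ [_ [[c [q [n [Fc [/NF Fq _] /NF Fn ->]]]] /lc1[f Ff ->] ->]]].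
have F0' := const0 fr.
have := bracket_M c q n 0 0 f Fc Fq Fn F0' F0' Ff.
by rewrite !scale0r !add0r !mulr0 subr0 mul0r scale0r => ->.
Qed.

Lemma frame_commute (X1 X2 X3 : selfmap R) : frame X1 X2 X3 0 ->
  pairwise_commute [set X1; X2; X3].
Proof.
move=> fr; have b12 : bracket X1 X2 = 0.
  by apply: selfmapP => x; rewrite bracketE (frame_comm12 fr) subrr.
have b13 : bracket X1 X3 = 0.
  by apply: selfmapP => x; rewrite bracketE (frame_comm13 fr) subrr.
have b32 : bracket X3 X2 = 0.
  by apply: selfmapP => x; rewrite bracketE (frame_comm32 fr) mul0r addr0 subrr.
move=> D E [[->|->]|->] [[->|->]|->]; rewrite ?bracketDD //.
- by rewrite bracketC b12 oppr0.
- by rewrite bracketC b32 oppr0.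
- by rewrite bracketC b13 oppr0.
Qed.

Section WithSlice.
Variables (X1 X2 X3 : selfmap R) (t a : R).
Hypothesis fr : frame X1 X2 X3 t.
Let d1 := frame_der1 fr.
Let d2 := frame_der2 fr.
Let d3 := frame_der3 fr.
Local Notation N := (nil_functions X1 X2 X3).
Local Notation F := (joint_constants X1 X2 X3).
Local Notation M := (model X1 X2 X3).
Hypotheses (Na : N a) (a2 : X2 a = 0) (a3 : X3 a = 1).
Local Notation Fa := (lspan F (range (dpow a) : set R^o)).

Lemma constants_nat_inv n : F (n.+1%:R)^-1.
Proof. by apply: (constV fr); split; rewrite der_nat. Qed.

Lemma nil_dpow b i : N b -> N (dpow b i).
Proof.
move=> Nb; apply: (nilM fr); last first.
  by apply: nil_const; rewrite -[i`!]prednK ?fact_gt0 //; exact: constants_nat_inv.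
by elim: i => [|i IHi]; [exact/nil_const/(const1 fr)|rewrite exprS; exact: (nilM fr)].
Qed.

Lemma nil_subspace : subspace F (N : set R^o).
Proof.
split; first exact/nil_const/(const0 fr).
  by move=> x y; apply: (nilD fr).
by move=> c x Fc; apply: (nilZ fr).
Qed.

Lemma Fa_nil p : Fa p -> N p /\ X2 p = 0.
Proof.
move=> Pp; split; move: p Pp; apply: lspan_min.
- exact: nil_subspace.
- by move=> _ [i _ <-]; apply: nil_dpow.
- split; first exact: (der0 d2).
    by move=> x y /= x2 y2; rewrite (derD d2) x2 y2 addr0.
  by move=> c x [_ c2 _] /= x2; rewrite [_ *: _](_ : _ = c * x) // (derZ d2) // x2 mulr0.
- by move=> _ [i _ <-] /=; apply: der_dpow0.
Qed.

Lemma Fa_const c : F c -> Fa c.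
Proof.
move=> Fc; exists 1%N, (fun=> c), (fun=> dpow a 0); split => //.
by rewrite big_ord1 /dpow expr0 fact0 divr1 [RHS]mulr1.
Qed.

Lemma Fa_subspace : subspace F Fa.
Proof. by apply: lspan_subspace; exact: (constM fr). Qed.

Lemma Fa_antiderivative p : Fa p -> exists2 s, Fa s & X3 s = p.
Proof.
move=> /(antiderivative_span (g' := dpow a \o S) d3)[].
- by move=> c [].
- by move=> i; apply: der_dpow.
move=> s Ps Xs; exists s => //; move: Ps; apply: lspan_min; first exact: Fa_subspace.
move=> _ [i _ <-]; apply: sub_lspan; first exact: (const1 fr).
by exists i.+1.
Qed.

(** Polynomials in [a] have antiderivatives along [X3], and the functions
    killed by [X2] and [X3] among the nil ones are the constants. *)
Lemma nil_ker2_Fa q : N q -> X2 q = 0 -> Fa q.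
Proof.
move=> Nq q2; apply: (@nilpotent_sub_of_antiderivatives _ X3
  [set q | N q /\ X2 q = 0]) => //.
- by move=> x [Nx x2]; split; [exact: (nil_X3 fr)|rewrite -(comm_nil fr) // x2 (der0 d3)].
- move=> x y [Nx x2] [Ny y2]; split; first exact: (nilB fr).
  by rewrite (derB d2) x2 y2 subr0.
- by have [] := Fa_subspace.
- by move=> p /Fa_nil.
- exact: Fa_antiderivative.
- by move=> x [Nx x2] x3; apply: Fa_const; split => //; case: Nx.
- by move=> x [[]].
Qed.

(** Iterating [X2] leads to [y] with [X2 y] nonzero and killed by [X2].
    Iterating [X3] then makes [X2 y] a nonzero constant, and division by it
    gives a slice of [X2]. Its derivative along [X3] is a polynomial in [a], an
    antiderivative of which is subtracted from the slice. *)
Lemma second_slice : ~ (forall n, N n -> X2 n = 0) ->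
  exists b, [/\ N b, X2 b = 1 & X3 b = 0].
Proof.
move=> /existsNP[r /not_implyP[Nr /eqP r2]].
have [|j [u0 u2]] := last_nonconstant d2 _ r2; first by case: Nr.
set y := iter j X2 r in u0 u2; have Ny : N y by exact: (nil_iter2 fr).
have Nu := nil_X2 fr Ny; have [u1 _ u3] := Nu.
have [l [e0 e3]] := last_nonzero u3 u0.
set e := iter l X3 (X2 y) in e0 e3.
have Ne : N e by exact: (nil_iter3 fr).
have y'2 : X2 (iter l X3 y) = e.
  by rewrite -(comm_iter3 fr) //; case: Ny.
have Fe : F e.
  split => //; first by case: Ne.
  by rewrite -(comm_iter3 fr) // u2 (der_iter0 d3).
have [f1 f2 f3] := constV fr Fe.
set b := e^-1 * iter l X3 y.
have Nb : N b := nilZ fr (constV fr Fe) (nil_iter3 fr l Ny).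
have b2 : X2 b = 1 by rewrite (derZ d2) // y'2 mulVf.
have [|s Ps Xs] := @Fa_antiderivative (X3 b).
  apply: nil_ker2_Fa; first exact: (nil_X3 fr).
  by rewrite -(comm_nil fr) // b2 (der1 d3).
have [Ns s2] := Fa_nil Ps.
exists (b - s); split; first exact: (nilB fr).
  by rewrite (derB d2) s2 subr0.
by rewrite (derB d3) Xs subrr.
Qed.

Lemma model_type2 : (forall n, N n -> X2 n = 0) -> type2 M.
Proof.
move=> N2; have [s Ps X3s] : exists2 s, Fa s & X3 s = t.
  by apply: Fa_antiderivative; apply: nil_ker2_Fa; [|apply: N2]; exact: frame_nil fr.
have [Ns s2] := Fa_nil Ps.
set X2' : selfmap R := X2 - s *: X1.
have X2'E x : N x -> X2' x = X2 x by case=> x1 _ _; apply: shearedE.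
have fr' : frame X1 X2' X3 0 := sheared_frame fr Ns X3s.
have M' : model X1 X2' X3 = M := sheared_model fr Ns.
have [a1 _ _] := Na.
exists X1, X2', X3, a; split.
- by rewrite -M' => _ [[->|->]|->];
    [exact: model_X1 fr'|exact: model_X2 fr'|exact: model_X3 fr'].
- by split => //; rewrite X2'E.
- exact: frame_commute.
rewrite (constants_model fr); set G := lspan _ _.
have subG : subspace F G by apply: lspan_subspace; exact: (constM fr).
have F' : joint_constants X1 X2' X3 = F := sheared_const X1 X2 X3 s.
have N' : nil_functions X1 X2' X3 = N := sheared_nil fr s.
have F1 := const1 fr.
apply/seteqP; split.
  rewrite -M'; apply: model_min; rewrite ?F' ?N' //.
  - by apply: sub_lspan => //; left; left.
  - move=> q Nq _; apply: (lspan_scale subG _ (nil_ker2_Fa Nq (N2 _ Nq))) => i.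
    by apply: sub_lspan => //; right; exists i.
  - move=> n Nn; apply: (lspan_scale subG _ (nil_ker2_Fa Nn (N2 _ Nn))) => i.
    by apply: sub_lspan => //; left; right; exists i.
apply: lspan_min; first exact: (model_subspace fr).
have Ni i := nil_dpow i Na.
move=> _ [[->|[i _ <-]]|[i _ <-]]; first exact: (model_X3 fr).
  exact: (model_scale_X1 fr).
by rewrite -M'; apply: (model_scale_X2 fr'); rewrite ?N' ?X2'E ?N2.
Qed.

Section TwoSlices.
Variable b : R.
Hypotheses (Nb : N b) (b2 : X2 b = 1) (b3 : X3 b = 0).
Let monomial (ij : nat * nat) : R := dpow a ij.1 * dpow b ij.2.
Local Notation Fab := (lspan F (range monomial : set R^o)).

Lemma nil_monomial ij : N (monomial ij).
Proof. by apply: (nilM fr); apply: nil_dpow. Qed.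

Lemma Fab_subspace : subspace F Fab.
Proof. by apply: lspan_subspace; exact: (constM fr). Qed.

Lemma Fab_nil : Fab `<=` N.
Proof. by apply: (lspan_min nil_subspace) => _ [ij _ <-]; apply: nil_monomial. Qed.

Lemma Fab_antiderivative2 p : Fab p -> exists2 s, Fab s & X2 s = p.
Proof.
move=> /(antiderivative_span (g' := fun ij => monomial (ij.1, ij.2.+1)) d2)[].
- by move=> c [].
- move=> [i j]; rewrite /monomial /= (derM d2) (der_dpow0 _ d2 a2) mul0r add0r.
  by rewrite (der_dpow char0 _ d2 b2).
move=> s Ps Xs; exists s => //; move: Ps; apply: lspan_min; first exact: Fab_subspace.
move=> _ [ij _ <-]; apply: sub_lspan; first exact: (const1 fr).
by exists (ij.1, ij.2.+1).
Qed.

Lemma Fab_antiderivative3 p : Fab p -> exists2 s, Fab s & X3 s = p.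
Proof.
move=> /(antiderivative_span (g' := fun ij => monomial (ij.1.+1, ij.2)) d3)[].
- by move=> c [].
- move=> [i j]; rewrite /monomial /= (derM d3) (der_dpow0 _ d3 b3).
  by rewrite (der_dpow char0 _ d3 a3) mulr0 addr0.
move=> s Ps Xs; exists s => //; move: Ps; apply: lspan_min; first exact: Fab_subspace.
move=> _ [ij _ <-]; apply: sub_lspan; first exact: (const1 fr).
by exists (ij.1.+1, ij.2).
Qed.

Lemma Fa_Fab : Fa `<=` Fab.
Proof.
apply: (lspan_min Fab_subspace) => _ [i _ <-].
apply: sub_lspan; first exact: (const1 fr).
by exists (i, 0%N) => //; rewrite /monomial /dpow /= expr0 fact0 divr1 mulr1.
Qed.

(** Integration along [X2] this time: polynomials in [a] and [b] have
    antiderivatives in [b], and the kernel of [X2] was found to be [F[a]]. *)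
Lemma nil_Fab : N `<=` Fab.
Proof.
apply: (@nilpotent_sub_of_antiderivatives _ X2) => //.
- by move=> x; apply: (nil_X2 fr).
- by move=> x y; apply: (nilB fr).
- by have [] := Fab_subspace.
- exact: Fab_nil.
- exact: Fab_antiderivative2.
- by move=> x Nx x2; apply: Fa_Fab; apply: nil_ker2_Fa.
- by move=> x [].
Qed.

Lemma model_type3 : type3 M.
Proof.
have [s Ps X3s] := Fab_antiderivative3 (nil_Fab (frame_nil fr)).
have Ns := Fab_nil Ps.
set X2' : selfmap R := X2 - s *: X1.
have X2'E x : N x -> X2' x = X2 x by case=> x1 _ _; apply: shearedE.
have fr' : frame X1 X2' X3 0 := sheared_frame fr Ns X3s.
have M' : model X1 X2' X3 = M := sheared_model fr Ns.
have [[a1 _ _] [b1 _ _]] := (Na, Nb).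
exists X1, X2', X3, a, b; split.
- by rewrite -M' => _ [[->|->]|->];
    [exact: model_X1 fr'|exact: model_X2 fr'|exact: model_X3 fr'].
- by split => //; rewrite X2'E.
- by split => //; rewrite X2'E.
- exact: frame_commute.
rewrite (constants_model fr); set G := lspan _ _.
have subG : subspace F G by apply: lspan_subspace; exact: (constM fr).
have F' : joint_constants X1 X2' X3 = F := sheared_const X1 X2 X3 s.
have N' : nil_functions X1 X2' X3 = N := sheared_nil fr s.
have F1 := const1 fr.
apply/seteqP; split.
  rewrite -M'; apply: model_min; rewrite ?F' ?N' //.
  - by apply: sub_lspan => //; left; left.
  - move=> q Nq; rewrite X2'E // => q2.
    apply: (lspan_scale subG _ (nil_ker2_Fa Nq q2)) => i.
    by apply: sub_lspan => //; left; right; exists i.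
  - move=> n Nn; apply: (lspan_scale subG _ (nil_Fab Nn)) => ij.
    by apply: sub_lspan => //; right; exists ij.
apply: lspan_min; first exact: (model_subspace fr).
move=> _ [[->|[i _ <-]]|[ij _ <-]]; first exact: (model_X3 fr).
  have Ni := nil_dpow i Na.
  by rewrite -M'; apply: (model_scale_X2 fr'); rewrite ?N' ?X2'E //; apply: der_dpow0.
by apply: (model_scale_X1 fr); apply: nil_monomial.
Qed.

End TwoSlices.

Lemma model_type2_or_type3 : type2 M \/ type3 M.
Proof.
have [N2|/second_slice[b [Nb b2 b3]]] := pselect (forall n, N n -> X2 n = 0).
  by left; apply: model_type2.
by right; apply: model_type3 Nb b2 b3.
Qed.

End WithSlice.
End Types.

(** * Derivations of a fraction field *)
Section WA.
Variables (K : fieldType) (A : idomainAlgType K).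
Local Notation R := {fraction A}.

Lemma WA_subspace : subspace setT (WA A).
Proof. exact: lspan_subspace. Qed.

Lemma WA_der D : WA A D -> is_der D /\ range (frac_alg A) `<=` [set r | D r = 0].
Proof.
move: D; apply: lspan_min.
  split.
  - by split; [exact: is_der0|].
  - move=> D E [dD kD] [dE kE]; split; first exact: is_derD.
    by move=> r Sr /=; rewrite addE kD // kE // addr0.
  - move=> c D _ [dD kD]; split; first exact: is_derZ.
    by move=> r Sr /=; rewrite scaleE kD // mulr0.
move=> D [[DD DZ DM] _]; have dD : is_der D by split.
split => // _ [k _ <-]; have := DZ k 1; rewrite mulr1 => DZ1.
by rewrite /mkset DZ1 (der1 dD) mulr0.
Qed.

Lemma fraction_char0 : [pchar K] =i pred0 -> forall n, n.+1%:R != 0 :> R.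
Proof.
move=> /GRing.pcharf0P charK n.
by rewrite -(rmorph_nat (frac_alg A)) fmorph_eq0 charK.
Qed.

Variable L : set (selfmap R).
Hypothesis maxL : maximal_locally_nilpotent (range (frac_alg A)) (WA A) L.

(** The model is a locally nilpotent subalgebra of [WA A], whatever the frame,
    as long as the latter is made of elements of [WA A]. *)
Lemma maximal_model X1 X2 X3 t : frame X1 X2 X3 t ->
  WA A X1 -> WA A X2 -> WA A X3 -> L `<=` model X1 X2 X3 ->
  model X1 X2 X3 = L.
Proof.
move=> fr W1 W2 W3; have [_ _] := maxL; apply; last first.
  apply: (model_locally_nilpotent fr) => r Sr.
  by split; apply: (WA_der _).2 Sr.
split; last exact: (model_bracket fr).
  have [_ WD WZ] := WA_subspace.
  move=> _ [c [q [n [_ _ _ ->]]]].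
  by apply: (WD); [apply: WD|]; apply: WZ.
apply: subspace_sub (model_subspace fr) => r Sr.
by split; apply: (WA_der _).2 Sr.
Qed.

End WA.

(** Derivations that kill the constants are linear over them, so only the
    closure properties have to be assumed. *)
Lemma derivations_lie_algebra (R : fieldType) (L : set (selfmap R)) :
  (forall D, L D -> is_der D) -> subspace (constants L) L ->
  (forall D E, L D -> L E -> L (bracket D E)) ->
  lie_algebra_over (constants L) L.
Proof.
move=> Lder subL Lb; split => //.
- move=> c D D' E Fc LD LD' LE.
  have [dD dD' dE] := And3 (Lder _ LD) (Lder _ LD') (Lder _ LE).
  have Ec := Fc E LE.
  split; apply: selfmapP => x; rewrite !(bracketE, addE, scaleE).
    by rewrite (derD dE) (derZ dE) //; ring.
  by rewrite (derD dE) (derZ dE) //; ring.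
- by move=> D _; exact: bracketDD.
- move=> D E G LD LE LG.
  have [dD dE dG] := And3 (Lder _ LD) (Lder _ LE) (Lder _ LG).
  apply: selfmapP => x; rewrite !(addE, bracketE).
  rewrite !(derB dD, derB dE, derB dG).
  by rewrite (_ : (0 : selfmap R) x = 0) //; ring.
Qed.

Theorem theorem2 (K : fieldType) (charK : [pchar K] =i pred0)
    (A : idomainAlgType K) (L : set (selfmap {fraction A}))
    (maxL : maximal_locally_nilpotent (range (frac_alg A)) (WA A) L)
    (rkL : rank_eq L 3) :
  [/\ lspan (constants L) L = L,
      lie_algebra_over (constants L) L
    & type1 L \/ type2 L \/ type3 L].
Proof.
have [[LW subL Lb] nilL _] := maxL; have [v [v_indep v_span]] := rkL.
have char0 := fraction_char0 A charK.
have Lder D : L D -> is_der D by move=> /LW/WA_der[].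
have S1 : range (frac_alg A) 1 by exists 1; rewrite ?rmorph1.
have L_lie : lie_subalgebra (range (frac_alg A)) L L by split.
have [X1 [X2 [X3 [t [[L1 L2 L3] indep fr FL LM]]]]] :=
  adapted_frame S1 L_lie nilL Lder v_indep v_span.
have [W1 W2 W3] := And3 (LW _ L1) (LW _ L2) (LW _ L3).
have ML := maximal_model maxL fr W1 W2 W3 LM.
have subFL : subspace (constants L) L by rewrite FL -ML; exact: model_subspace fr.
split.
- apply/seteqP; split; first exact: lspan_min.
  by apply: sub_lspan; rewrite FL; exact: const1 fr.
- exact: derivations_lie_algebra.
have [QF|[a [Na a2 a3]]] := constants_or_first_slice fr; last first.
  by right; rewrite -ML; apply: (model_type2_or_type3 char0 fr Na a2 a3).
have [NF|nNF] := pselect (nil_functions X1 X2 X3 `<=` joint_constants X1 X2 X3).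
  by left; rewrite -ML; apply: (model_type1 fr).
(* The model of the exchanged frame contains that of the first one, hence L. *)
have [c [b [Fc [fr' MM' Nb b2 b3]]]] := exchange_frame fr QF nNF.
have WX' : WA A (X3 - c *: X2).
  have [_ WD WZ] := WA_subspace A; rewrite -scaleN1r.
  by apply: (WD) => //; do 2 apply: (WZ) => //.
right; rewrite -(maximal_model maxL fr' W1 WX' W2 (subset_trans LM MM')).
exact: (model_type2_or_type3 char0 fr' Nb b2 b3).
Qed.
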